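(* Let $E/\mathbb{Q}$ be an elliptic curve and let $K=\mathbb{Q}(\sqrt{d})$ be a quadratic field with discriminant $d_K$ such that there exists a point $P\in E(K)[9]\setminus E(\mathbb{Q})$ of order $9$. Then $3\mid d_K$ if and only if $E$ has additive reduction at $3$ and the Kodaira symbol of $E$ at $3$ is not $IV$.
   Context: $d$ is a square-free integer and $K=\mathbb{Q}(\sqrt d)$ is a quadratic field over $\mathbb{Q}$; $d_K$ denotes the discriminant of $K|\mathbb{Q}$. $E(K)$ is the group of $K$-rational points of $E$, and $E(K)[9]$ its $9$-torsion subgroup. Reduction type and Kodaira symbol at $3$ are those of $E$ viewed over $\mathbb{Q}_3$. *)

(* Defs.v *)
From HB Require Import structures.
From mathcomp Require Import all_boot all_order all_algebra all_field.

Set Implicit Arguments.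
Unset Strict Implicit.
Unset Printing Implicit Defensive.

Import Order.TTheory GRing.Theory Num.Theory.
Local Open Scope ring_scope.

(* y^2 + a1 x y + a3 y = x^3 + a2 x^2 + a4 x + a6 *)
Record weierstrass (R : Type) := Weierstrass
  { wa1 : R; wa2 : R; wa3 : R; wa4 : R; wa6 : R }.

Definition map_weierstrass (R S : Type) (f : R -> S) (W : weierstrass R) :
  weierstrass S :=
  Weierstrass (f (wa1 W)) (f (wa2 W)) (f (wa3 W)) (f (wa4 W)) (f (wa6 W)).

Section Weierstrass.
Variable F : fieldType.
Implicit Types W : weierstrass F.

Definition wb2 W : F := wa1 W ^+ 2 + 4 * wa2 W.
Definition wb4 W : F := 2 * wa4 W + wa1 W * wa3 W.
Definition wb6 W : F := wa3 W ^+ 2 + 4 * wa6 W.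
Definition wb8 W : F :=
  wa1 W ^+ 2 * wa6 W + 4 * wa2 W * wa6 W - wa1 W * wa3 W * wa4 W
  + wa2 W * wa3 W ^+ 2 - wa4 W ^+ 2.
Definition wdisc W : F :=
  - wb2 W ^+ 2 * wb8 W - 8 * wb4 W ^+ 3 - 27 * wb6 W ^+ 2
  + 9 * wb2 W * wb4 W * wb6 W.

Definition is_elliptic W : bool := wdisc W != 0.

Definition on_curve W (x y : F) : Prop :=
  y ^+ 2 + wa1 W * x * y + wa3 W * y
  = x ^+ 3 + wa2 W * x ^+ 2 + wa4 W * x + wa6 W.

(* The model obtained by the substitution
   x = u^2 x' + r,  y = u^3 y' + u^2 s x' + t. *)
Definition wchange (u r s t : F) W : weierstrass F :=
  Weierstrass
    ((wa1 W + 2 * s) / u)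
    ((wa2 W - s * wa1 W + 3 * r - s ^+ 2) / u ^+ 2)
    ((wa3 W + r * wa1 W + 2 * t) / u ^+ 3)
    ((wa4 W - s * wa3 W + 2 * r * wa2 W - (t + r * s) * wa1 W
      + 3 * r ^+ 2 - 2 * s * t) / u ^+ 4)
    ((wa6 W + r * wa4 W + r ^+ 2 * wa2 W + r ^+ 3 - t * wa3 W - t ^+ 2
      - r * t * wa1 W) / u ^+ 6).

Definition is_model_of (E W : weierstrass F) : Prop :=
  exists u r s t : F, u != 0 /\ W = wchange u r s t E.

(* At a singular point (x, y), the quadratic part of the equation is
   Y^2 + a1 X Y - (3 x + a2) X^2; the point is a cusp when the two tangent
   directions coincide, i.e. when the discriminant of this form vanishes. *)
Definition has_cusp W : Prop :=
  exists x y : F,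
    [/\ on_curve W x y,
        2 * y + wa1 W * x + wa3 W = 0,
        wa1 W * y = 3 * x ^+ 2 + 2 * wa2 W * x + wa4 W
      & wa1 W ^+ 2 + 4 * (3 * x + wa2 W) = 0].

(* None is the point at infinity. *)
Definition point := option (F * F).

Definition is_point W (P : point) : Prop :=
  if P is Some (x, y) then on_curve W x y else True.

Definition point_add W (P Q : point) : point :=
  match P, Q with
  | None, _ => Q
  | _, None => P
  | Some (x1, y1), Some (x2, y2) =>
    if (x1 == x2) && (y1 + y2 + wa1 W * x2 + wa3 W == 0) then None else
    let l := if x1 == x2
             then (3 * x1 ^+ 2 + 2 * wa2 W * x1 + wa4 W - wa1 W * y1)
                  / (2 * y1 + wa1 W * x1 + wa3 W)
             else (y2 - y1) / (x2 - x1) in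
    let x3 := l ^+ 2 + wa1 W * l - wa2 W - x1 - x2 in
    Some (x3, - (l + wa1 W) * x3 - (y1 - l * x1) - wa3 W)
  end.

Definition point_mul W (n : nat) (P : point) : point :=
  iter n (point_add W P) None.

Definition point_order W (P : point) (n : nat) : Prop :=
  [/\ (0 < n)%N, point_mul W n P = None
    & forall m : nat, (0 < m < n)%N -> point_mul W m P <> None].

End Weierstrass.

Definition map_point (F K : fieldType) (f : F -> K) (P : point F) : point K :=
  omap (fun xy => (f xy.1, f xy.2)) P.

Section LocalReduction.
Variable p : nat.
Implicit Types E W : weierstrass rat.

(* Models at p are taken over Q, with integrality tested in the discrete
   valuation ring Z_(p): it has the same uniformizer and residue field as its
   completion Z_p, and Q is dense in Q_p, so minimality, the reduced curve and
   Tate's algorithm give the same answers as over Q_p. *)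

(* The p-adic valuation, with the junk value 0 at 0. *)
Definition vp (x : rat) : int :=
  (logn p `|numq x|%N)%:Z - (logn p `|denq x|%N)%:Z.

(* x belongs to p^k Z_(p) *)
Definition vp_ge (k : nat) (x : rat) : bool := (x == 0) || (k%:Z <= vp x).

Definition p_integral W : bool :=
  [&& vp_ge 0 (wa1 W), vp_ge 0 (wa2 W), vp_ge 0 (wa3 W),
      vp_ge 0 (wa4 W) & vp_ge 0 (wa6 W)].

Definition minimal_model E W : Prop :=
  [/\ is_model_of E W, p_integral W
    & forall W', is_model_of E W' -> p_integral W' ->
        vp (wdisc W) <= vp (wdisc W')].

(* On rationals of nonnegative p-adic valuation, ratr : rat -> 'F_p is the
   reduction map from Z_(p) to its residue field. *)
Definition additive_reduction E : Prop :=
  exists W, minimal_model E W /\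
    has_cusp (map_weierstrass (ratr : rat -> 'F_p) W).

Inductive kodaira_symbol :=
  | KI of nat | KII | KIII | KIV
  | KIs of nat | KIVs | KIIIs | KIIs.

Definition coef_val_ge (k1 k2 k3 k4 k6 : nat) W : bool :=
  [&& vp_ge k1 (wa1 W), vp_ge k2 (wa2 W), vp_ge k3 (wa3 W),
      vp_ge k4 (wa4 W) & vp_ge k6 (wa6 W)].

Definition pred_unit (x : rat) : bool := ~~ vp_ge 1 x.

(* The quotient a_(i,k) = a_i / p^k of Tate's algorithm. *)
Definition tq (x : rat) (k : nat) : rat := x / p%:R ^+ k.

(* a x^2 + b x + c *)
Definition disc2 (a b c : rat) : rat := b ^+ 2 - 4 * a * c.

(* x^3 + a x^2 + b x + c *)
Definition disc3 (a b c : rat) : rat :=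
  a ^+ 2 * b ^+ 2 - 4 * b ^+ 3 - 4 * a ^+ 3 * c - 27 * c ^+ 2
  + 18 * a * b * c.

(* The exit conditions of Tate's algorithm at p, for an equation on which all
   the translations required by the algorithm have already been performed.
   A polynomial over Z_(p) whose degree is preserved by reduction has distinct
   roots over an algebraic closure of F_p exactly when its discriminant is a
   unit; the polynomials that occur are
     T^3 + a_(2,1) T^2 + a_(4,2) T + a_(6,3)             for I0*,
     Y^2 + a_(3,m+1) Y - a_(6,2m+2)                      for I(2m-1)*,
     a_(2,1) X^2 + a_(4,m+2) X + a_(6,2m+3)              for I(2m)*, m > 0,
     Y^2 + a_(3,2) Y - a_(6,4)                           for IV*. *)
Definition tate_exit (k : kodaira_symbol) W : bool :=
  match k with
  | KI 0 => p_integral W && pred_unit (wdisc W)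
  | KI n => [&& coef_val_ge 0 0 1 1 1 W, pred_unit (wb2 W)
              & vp (wdisc W) == n%:Z]
  | KII => [&& coef_val_ge 0 0 1 1 1 W, vp_ge 1 (wb2 W)
             & ~~ vp_ge 2 (wa6 W)]
  | KIII => [&& coef_val_ge 0 0 1 1 2 W, vp_ge 1 (wb2 W)
              & ~~ vp_ge 3 (wb8 W)]
  | KIV => [&& coef_val_ge 0 0 1 1 2 W, vp_ge 1 (wb2 W), vp_ge 3 (wb8 W)
             & ~~ vp_ge 3 (wb6 W)]
  | KIs 0 => coef_val_ge 1 1 2 2 3 W &&
      pred_unit (disc3 (tq (wa2 W) 1) (tq (wa4 W) 2) (tq (wa6 W) 3))
  | KIs n => ~~ vp_ge 2 (wa2 W) &&
      let m := uphalf n in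
      if odd n then
        coef_val_ge 1 1 m.+1 m.+2 (m.*2 + 2) W &&
        pred_unit (disc2 1 (tq (wa3 W) m.+1) (- tq (wa6 W) (m.*2 + 2)))
      else
        coef_val_ge 1 1 m.+2 m.+2 (m.*2 + 3) W &&
        pred_unit (disc2 (tq (wa2 W) 1) (tq (wa4 W) m.+2)
                         (tq (wa6 W) (m.*2 + 3)))
  | KIVs => coef_val_ge 1 2 2 3 4 W &&
      pred_unit (disc2 1 (tq (wa3 W) 2) (- tq (wa6 W) 4))
  | KIIIs => coef_val_ge 1 2 3 3 5 W && ~~ vp_ge 4 (wa4 W)
  | KIIs => coef_val_ge 1 2 3 4 5 W && ~~ vp_ge 6 (wa6 W)
  end.

Definition has_kodaira_symbol E (k : kodaira_symbol) : Prop :=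
  exists W, is_model_of E W /\ tate_exit k W.

End LocalReduction.

Definition square_free (d : int) : Prop :=
  forall m : int, (m ^+ 2 %| d)%Z -> `|m| = 1.

Section NumberField.
Variable K : fieldExtType rat.

Definition algebraic_integer (x : K) : Prop :=
  integralOver (fun m : int => m%:~R : K) x.

Definition field_trace (x : K) : rat :=
  \tr (passmx.mxof (vbasis {:K}) (vbasis {:K}) (amulr x)).

Definition integral_basis (b : (\dim {:K}).-tuple K) : Prop :=
  basis_of {:K} b /\
  forall x : K, algebraic_integer x <->
    exists c : 'I_(\dim {:K}) -> int, x = \sum_i (c i)%:~R * b`_i.

(* The sign and value of D do not depend on the integral basis. *)
Definition is_field_discriminant (D : int) : Prop :=
  exists b : (\dim {:K}).-tuple K, integral_basis b /\
    D%:~R = \det (\matrix_(i < \dim {:K}, j < \dim {:K})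
                    field_trace (b`_i * b`_j)).

End NumberField.

(* Main.v *)
From HB Require Import structures.
From mathcomp Require Import all_boot all_order all_algebra all_field.
From mathcomp Require Import ring lra zify.
Require Import Defs.
Set Implicit Arguments.
Unset Strict Implicit.
Unset Printing Implicit Defensive.
Import Order.TTheory GRing.Theory Num.Theory.
Local Open Scope ring_scope.

(** Let A(t) = t^3 - 3 t^2 + 1 and B(t) = t (t - 1).  The curve
    y^2 + A x y + B^3 y = x^3 is the universal elliptic curve with a point P of
    order 9, written with 3 P at the origin: it is Tate's normal form
    y^2 + (1 - c) x y - b y = x^3 - b x^2, with P at the origin,
    c = t^2 (t - 1) and b = c (t^2 - t + 1), translated by 3 P.  Computing the
    first multiples of P, and going down from 9 P = 0, one finds t in K and a
    scaling factor u in K that bring E to this form ([order9_param]).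

    Let sigma be the conjugation of K over Q.  The proof first shows that t and
    u^2 are rational.

    - The abscissa r of 3 P is rational.  Otherwise 3 P and its conjugate
      generate E[3], hence K contains a primitive cube root of unity w and the
      discriminant factor A^3 - 27 B^3 is a cube in K ([flex_x_rational]).  This
      contradicts Fermat's theorem in degree 3 over Q(w), obtained by the usual
      descent in Z[w] ([eis_fermat3], [quadratic_fermat3]).
    - Now (uA)^2, (uA)(uB)^3 and (uB)^6 are coefficients of an equation over Q,
      so that A/B and its conjugate differ by a cube root of unity w.  If w is
      not 1, the factorizations A - 3 w B = (t + w^2)^3 and
      A - 3 w^2 B = (t + w)^3 at t and sigma(t) make A - 3 B a cube, and then
      A^3 - 27 B^3 as well, against Fermat's theorem again.  So A/B is a
      rational number s.  The roots of A(X) = s B(X) are permuted cyclically by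
      X |-> 1 / (1 - X), so they generate a cyclic extension of degree 1 or 3,
      and t, which is quadratic, is rational ([cyclic_cubic_root]).  Moreover
      sigma(u) is u or -u ([flex_param_rational]).

    If sigma(u) = u then P is a rational point, which is excluded.  So E is the
    twist by d of the curve with parameter t in Q ([order9_point_twist]), that
    is y^2 = x^3 + d A^2 x^2 + 8 d^2 A B^3 x + 16 d^3 B^6, where A and B may be
    replaced by their homogeneous forms at t = p/q.  There are two cases at 3.

    - If 3 does not divide p + q, then 3 divides B and not A.  The untwisted
      curve is multiplicative at 3; so is E when 3 does not divide d.  When 3
      divides d, the equation above is minimal, its reduction has a cusp, and
      the j-invariant has negative valuation.
    - If 3 divides p + q, then A^3 - 27 B^3 has valuation exactly 5.  When 3
      does not divide d, an explicit translate of the equation leaves Tate's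
      algorithm at type IV.  When 3 divides d, the equation above is minimal
      with a cusp, and its discriminant has valuation 11.

    An equation of type IV at 3 has a discriminant of valuation 5, 6 or 7 and a
    j-invariant of positive valuation ([tate_KIV_valuations]), which excludes
    this type in both cases with 3 dividing d.  Finally 3 divides d_K exactly
    when it divides d, because 4 d = f^2 d_K, where f is the index of Z[sqrt d]
    in the ring of integers ([dvd3_discriminant]). *)

(** * The addition law under changes of coordinates *)

(** Deduces an equation from another one with an explicit cofactor k: the
    remaining identity is left to the ring and field tactics. *)
Lemma eq_lin (R : pzRingType) (l r x y : R) (k : R) :
  l = r -> x - y = k * (l - r) -> x = y.
Proof. by move=> -> h; apply: subr0_eq; rewrite h subrr mulr0. Qed.

Lemma eq_lin2 (R : pzRingType) (l r l' r' x y : R) (k k' : R) :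
  l = r -> l' = r' -> x - y = k * (l - r) + k' * (l' - r') -> x = y.
Proof. by move=> -> -> h; apply: subr0_eq; rewrite h !subrr !mulr0 addr0. Qed.

Section Addition.
Variable F : fieldType.
Implicit Types (W : weierstrass F) (P Q : point F).

Lemma on_curve_same_x W (x y1 y2 : F) :
  on_curve W x y1 -> on_curve W x y2 ->
  y1 + y2 + wa1 W * x + wa3 W != 0 -> y1 = y2.
Proof.
move=> h1 h2 h; apply/subr0_eq/(mulIf h).
by apply: (eq_lin2 (k := 1) (k' := -1) h1 h2); ring.
Qed.

Lemma point_add_on_curve W P Q :
  is_point W P -> is_point W Q -> is_point W (point_add W P Q).
Proof.
case: P Q => [[x1 y1]|] [[x2 y2]|] //=.
case: eqP => [<-|/eqP ne] /= h1 h2; last first.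
  have dx : x2 - x1 != 0 by rewrite subr_eq0 eq_sym.
  set l := (y2 - y1) / (x2 - x1).
  have ey : y2 = y1 + l * (x2 - x1) by rewrite divfK // addrC subrK.
  move: h1 h2; rewrite /on_curve {}ey; move: l => l.
  case: W => a1 a2 a3 a4 a6 /= h1 h2.
  have e4 : a4 = l * (y1 + y1 + l * (x2 - x1)) + a1 * (y1 + l * (x2 - x1) + x1 * l)
     + a3 * l - (x1 ^+ 2 + x1 * x2 + x2 ^+ 2) - a2 * (x1 + x2).
    by apply/(mulIf dx)/(eq_lin2 (k := 1) (k' := -1) h1 h2); ring.
  have e6 : a6 = y1 ^+ 2 + a1 * x1 * y1 + a3 * y1 - (x1 ^+ 3 + a2 * x1 ^+ 2 + a4 * x1).
    by rewrite h1; ring.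
  by rewrite e6 e4; ring.
case: eqP => // /eqP hne; have ey := on_curve_same_x h1 h2 hne; subst y2.
have hd : 2 * y1 + wa1 W * x1 + wa3 W != 0 by rewrite mulr2n mulrDl !mul1r.
set l := _ / _.
have : l * (2 * y1 + wa1 W * x1 + wa3 W) = 3 * x1 ^+ 2 + 2 * wa2 W * x1 + wa4 W - wa1 W * y1.
  by rewrite divfK.
rewrite /is_point /on_curve; move: h1; rewrite /on_curve; move: l => l {h2 hne hd}.
case: W => a1 a2 a3 a4 a6 /= h1 hl.
have e4 : a4 = l * (2 * y1 + a1 * x1 + a3) - 3 * x1 ^+ 2 - 2 * a2 * x1 + a1 * y1.
  by rewrite hl; ring.
have e6 : a6 = y1 ^+ 2 + a1 * x1 * y1 + a3 * y1 - (x1 ^+ 3 + a2 * x1 ^+ 2 + a4 * x1).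
  by rewrite h1; ring.
by rewrite e6 e4; ring.
Qed.

Lemma point_mul_on_curve W P n : is_point W P -> is_point W (point_mul W n P).
Proof. by move=> hP; elim: n => //= n; apply: point_add_on_curve. Qed.

(** The effect on points of the substitution used by [wchange]. *)
Definition pchange (u r s t : F) : point F -> point F :=
  omap (fun xy => ((xy.1 - r) / u ^+ 2, (xy.2 - s * (xy.1 - r) - t) / u ^+ 3)).

(** The substitution is affine, so it maps chords and tangents to chords and
    tangents: the new slope is (l - s) / u.  Points of the curve are required
    because two points with the same abscissa must be equal or opposite for the
    slope in [point_add] to be that of the tangent. *)
Lemma pchange_add W u r s t P Q : u != 0 ->
  is_point W P -> is_point W Q ->
  pchange u r s t (point_add W P Q)
  = point_add (wchange u r s t W) (pchange u r s t P) (pchange u r s t Q).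
Proof.
move=> u0; case: P Q => [[x1 y1]|] [[x2 y2]|] //= h1 h2.
have -> : ((x1 - r) / u ^+ 2 == (x2 - r) / u ^+ 2) = (x1 == x2).
  by rewrite (inj_eq (mulIf _)) ?invr_eq0 ?expf_neq0 // (inj_eq (addIr _)).
have line l l' : l' = (l - s) / u ->
  pchange u r s t (let x3 := l ^+ 2 + wa1 W * l - wa2 W - x1 - x2 in
    Some (x3, - (l + wa1 W) * x3 - (y1 - l * x1) - wa3 W)) =
  let W' := wchange u r s t W in
  let x3 := l' ^+ 2 + wa1 W' * l' - wa2 W' - (x1 - r) / u ^+ 2 - (x2 - r) / u ^+ 2 in
  Some (x3, - (l' + wa1 W') * x3 -
     ((y1 - s * (x1 - r) - t) / u ^+ 3 - l' * ((x1 - r) / u ^+ 2)) - wa3 W').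
  by move=> -> /=; congr (Some (_, _)); field.
case: eqP => [ex|/eqP ne] /=; last first.
  have dx : x2 - x1 != 0 by rewrite subr_eq0 eq_sym.
  have dx' : x2 - r - (x1 - r) != 0 by rewrite (_ : _ - _ = x2 - x1) ?dx //; ring.
  by apply: line; field; rewrite ?u0 ?dx ?dx'.
subst x2.
have es : (y1 - s * (x1 - r) - t) / u ^+ 3 + (y2 - s * (x1 - r) - t) / u ^+ 3 +
      (wa1 W + 2 * s) / u * ((x1 - r) / u ^+ 2) +
      (wa3 W + r * wa1 W + 2 * t) / u ^+ 3 = (y1 + y2 + wa1 W * x1 + wa3 W) / u ^+ 3.
  by field.
rewrite es mulf_eq0 invr_eq0 expf_eq0 (negbTE u0) andbF orbF.
case: eqP => //= /eqP hne; apply: line.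
have hd : 2 * y1 + wa1 W * x1 + wa3 W != 0.
  by move: (hne); rewrite -(on_curve_same_x h1 h2 hne) mulr2n mulrDl !mul1r.
by field; rewrite ?u0 ?hd.
Qed.

Lemma pchange_mul W u r s t P n : u != 0 -> is_point W P ->
  pchange u r s t (point_mul W n P)
  = point_mul (wchange u r s t W) n (pchange u r s t P).
Proof.
move=> u0 hP; elim: n => //= n IH.
by rewrite pchange_add // ?IH //; apply: point_mul_on_curve.
Qed.
End Addition.

(** * Points of order 9 in Tate's normal form *)

Section TateNormalForm.
Variable F : fieldType.
Implicit Types (b c t : F).

Definition tate_form b c : weierstrass F :=
  Weierstrass (1 - c) (- b) (- b) 0 0.

(** The line through the origin and (x, y) has slope y/x and meets the curve
    at three points whose abscissas are 0, x and b y / x^2, by the product of the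
    roots. *)
Lemma tate_form_add b c x y : x != 0 ->
  y ^+ 2 + (1 - c) * x * y - b * y = x ^+ 3 - b * x ^+ 2 ->
  point_add (tate_form b c) (Some (0, 0)) (Some (x, y))
  = Some (b * y / x ^+ 2, b - (y / x + 1 - c) * (b * y / x ^+ 2)).
Proof.
move=> x0 e /=; rewrite eq_sym (negbTE x0) /= !subr0.
have -> : (y / x) ^+ 2 + (1 - c) * (y / x) - - b - x = b * y / x ^+ 2.
  by apply/(mulIf (expf_neq0 2 x0))/(eq_lin (k := 1) e); field.
by congr (Some (_, _)); ring.
Qed.

(** Going up, with d = b/c, the multiples of P are 2P = (b, bc),
    3P = (c, b - c), 4P = (d (d - 1), d^2 (c - d + 1)), and 5P has abscissa
    t d (t - 1) where t = c / (d - 1).  Going down, 8P = -P forces 7P = (b, 0),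
    6P = (c, c^2), and 5P to have the abscissa d (d - 1) of -4P.  Equating both
    abscissas of 5P gives d = t^2 - t + 1. *)
Lemma tate_form_order9 b c : b != 0 ->
  point_order (tate_form b c) (Some (0, 0)) 9 ->
  exists t, [/\ c = t ^+ 2 * (t - 1), b = c * (t ^+ 2 - t + 1) & c != 0].
Proof.
move=> b0 [_ P9 Pn].
set W := tate_form b c in P9 Pn *; set P : point F := Some (0, 0) in P9 Pn *.
have mulS n : point_mul W n.+1 P = point_add W P (point_mul W n P) by [].
have curve n : is_point W (point_mul W n P).
  by apply: point_mul_on_curve; rewrite /= /on_curve /=; ring.
have addO x y : on_curve W x y -> x != 0 -> y ^+ 2 + (1 - c) * x * y - b * y = x ^+ 3 - b * x ^+ 2.
  by rewrite /on_curve /= => e _; move: e; rewrite mulNr => ->; ring.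
have P1 : point_mul W 1 P = P by [].
have PP : point_add W P P = Some (b, b * c).
  rewrite /= eqxx /= !add0r mulr0 add0r oppr_eq0 (negbTE b0).
  by congr (Some (_, _)); field; rewrite ?oppr_eq0.
have P2 : point_mul W 2 P = Some (b, b * c) by rewrite mulS P1.
have PN : point_add W P (Some (0, b)) = None.
  by rewrite /= eqxx /= mulr0 addr0 add0r subrr eqxx.
(* The points of the curve with abscissa 0 are P and -P = (0, b). *)
have x0 n y : point_mul W n P = Some (0, y) -> y = 0 \/ y = b.
  move=> e; have := curve n; rewrite e /= /on_curve /= => h.
  have /eqP : y * (y - b) = 0.
    by apply: (eq_lin (k := 1) h); ring.
  by rewrite mulf_eq0 subr_eq0 => /orP[] /eqP; [left | right].
have P3 : point_mul W 3 P = Some (c, b - c).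
  rewrite mulS P2 tate_form_add //; last by ring.
  by congr (Some (_, _)); field.
have c0 : c != 0.
  by apply/eqP => c0; apply: (Pn 4%N) => //; rewrite mulS P3 c0 subr0 PN.
set d := b / c; have bE : b = c * d by rewrite /d; field.
have d0 : d != 0 by apply: contra_neq b0 => d0; rewrite bE d0 mulr0.
have P4 : point_mul W 4 P = Some (d * (d - 1), d ^+ 2 * (c - d + 1)).
  rewrite mulS P3 tate_form_add //; last by rewrite bE; ring.
  by rewrite bE; congr (Some (_, _)); field.
have d1 : d - 1 != 0.
  apply/eqP => d1; apply: (Pn 5%N) => //; rewrite mulS P4 d1 mulr0.
  have e : d = 1 by apply: subr0_eq.
  by rewrite (_ : _ * _ = b) ?PN // bE e; ring.
have x40 : d * (d - 1) != 0 by rewrite mulf_neq0.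
set t := c / (d - 1); have cE : c = t * (d - 1) by rewrite /t; field.
have [x5 [y5 [P5 x5E]]] : exists x5 y5, point_mul W 5 P = Some (x5, y5) /\ x5 = t * d * (t - 1).
  have := curve 4%N; rewrite P4 => h; rewrite mulS P4.
  rewrite tate_form_add //; last by apply: addO.
  eexists; eexists; split; first by [].
  by rewrite bE cE; field; rewrite d0 d1.
have {P9} P8 : point_mul W 8 P = Some (0, b).
  move: P9; rewrite mulS; case: (point_mul W 8 P) => [[x y]|] //.
  rewrite /= eq_sym; case: eqP => [->|//] /=; rewrite add0r mulr0 addr0.
  by case: eqP => // e _; rewrite (subr0_eq e).
(* From P + X = (x, y) to X = (x', y'); applied to X = 7P, 6P, 5P, starting
   from 8P = -P.  The value (b, bc) = 2P is excluded, since X would then be P,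
   whose abscissa is 0. *)
have pred n x y : (0 < n < 8)%N -> point_mul W n.+1 P = Some (x, y) -> (x, y) <> (b, b * c) ->
   exists x' y', [/\ point_mul W n P = Some (x', y'), x' != 0, x = b * y' / x' ^+ 2
     & y = b - (y' / x' + 1 - c) * x ].
  move=> /andP[n0 n8]; rewrite mulS; case E: (point_mul W n P) => [[x' y']|]; last first.
    by case: (Pn n) => //; rewrite n0 ltnS ltnW.
  have [e|x'0] := eqVneq x' 0.
    subst x'; case: (x0 _ _ E) => e; subst y'; first by rewrite PP => -[<- <-].
    by rewrite PN.
  have := curve n; rewrite E => h; rewrite tate_form_add //; last by apply: addO.
  by case=> <- <- _; exists x', y'.
have P7 : point_mul W 7 P = Some (b, 0).
  have [|x7 [y7 [E x70 ex _]]] := pred 7%N _ _ isT P8; first by case=> e; rewrite -e eqxx in b0.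
  have y70 : y7 = 0.
    by move/esym/eqP: ex; rewrite !mulf_eq0 invr_eq0 expf_eq0 /= (negbTE b0) (negbTE x70) orbF => /eqP.
  rewrite {}y70 in E; rewrite E; have := curve 7%N; rewrite E /= /on_curve /= => h.
  by congr (Some (_, _)); apply/(mulIf (expf_neq0 2 x70))/(eq_lin (k := -1) h); ring.
have P6 : point_mul W 6 P = Some (c, c ^+ 2).
  have [|x6 [y6 [E x60 ex ey]]] := pred 6%N _ _ isT P7.
    by case=> /eqP; rewrite eq_sym mulf_eq0 (negbTE b0) (negbTE c0).
  have y6E : y6 = x6 ^+ 2.
    by apply: (mulfI b0); rewrite {2}ex; field.
  have x6E : x6 = c.
    by apply/(mulfI b0)/(eq_lin (k := 1) ey); rewrite y6E; field.
  by rewrite E y6E x6E.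
have x5E' : x5 = d * (d - 1).
  have [|x5' [y5' [E x50 ex ey]]] := pred 5%N _ _ isT P6.
    by case=> e1 _; case/eqP: d1; rewrite /d -e1; field.
  move: P5; rewrite E => -[ex5 ey5]; rewrite -ex5.
  have y5E : y5' = x5' * (d - 1).
    have /eqP : c * (y5' / x5') = c * (d - 1).
      by apply: (eq_lin (k := 1) ey); rewrite bE; field.
    by rewrite (inj_eq (mulfI c0)) => /eqP <-; field.
  by apply: (mulfI c0); apply: (eq_lin (k := x5') ex); rewrite y5E bE; field.
have dE : d = t ^+ 2 - t + 1.
  apply: (mulfI d0); by apply: (eq_lin (k := -1) x5E'); rewrite x5E; ring.
have cE' : c = t ^+ 2 * (t - 1) by rewrite cE dE; ring.
by exists t; split=> //; rewrite -dE.
Qed.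
End TateNormalForm.

(** With [B9] below, the two coefficients of the universal curve
    y^2 + A x y + B^3 y = x^3 with a point of order 9. *)
Definition A9 (R : pzRingType) (t : R) : R := t ^+ 3 - 3 * t ^+ 2 + 1.
Definition B9 (R : pzRingType) (t : R) : R := t * (t - 1).

Section Order9.
Variable F : fieldType.
Implicit Types (W : weierstrass F) (m n r : F).

(** The coefficients of 4 x^3 + b2 x^2 + 2 b4 x + b6
    = 4 (x - r)^3 + (m (x - r) + n)^2.  After completion of the square,
    this is the equation y^2 + m x y + n y = x^3
    with the flex (0, 0) moved to the abscissa r; such flexes are the points of
    order 3. *)
Definition flex_form W r m n : Prop :=
  [/\ wb2 W = m ^+ 2 - 12 * r,
      wb4 W = 6 * r ^+ 2 - r * m ^+ 2 + m * n
    & wb6 W = (n - m * r) ^+ 2 - 4 * r ^+ 3 ].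

(** The substitution that brings W to Tate's normal form has s equal to the
    slope of the tangent at P, which makes a4 vanish, and u = a3 / a2, which makes
    a2 and a3 equal.  Then a3 is nonzero because 2P is not 0, and a2 is nonzero
    because 3P is not 0.  The abscissa x + u^2 c is that of 3P. *)
Lemma order9_param W x y : is_point W (Some (x, y)) ->
  point_order W (Some (x, y)) 9 ->
  exists t u, let c := t ^+ 2 * (t - 1) in
    [/\ u != 0, c != 0,
        flex_form W (x + u ^+ 2 * c) (u * A9 t) ((u * B9 t) ^+ 3)
      & 2 * y + wa1 W * x + wa3 W = u ^+ 3 * (c * (t ^+ 2 - t + 1))].
Proof.
move=> hP ord; have [_ P9 Pn] := ord.
set P := Some (x, y) in hP P9 Pn ord.
set a3 := wa3 W + x * wa1 W + 2 * y.
have a30 : a3 != 0.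
  apply/eqP => e; apply: (Pn 2%N) => //=; rewrite eqxx /=.
  rewrite (_ : y + y + wa1 W * x + wa3 W = a3); first by rewrite e eqxx.
  by rewrite /a3; ring.
pose s := (wa4 W - y * wa1 W + 2 * x * wa2 W + 3 * x ^+ 2) / a3.
pose a2 := wa2 W - s * wa1 W + 3 * x - s ^+ 2.
have a20 : a2 != 0.
  apply/eqP => e; apply: (Pn 3%N) => //=; rewrite eqxx /=.
  rewrite (_ : y + y + wa1 W * x + wa3 W = a3) ?(negbTE a30); last by rewrite /a3; ring.
  rewrite (_ : _ / _ = s); last first.
    by rewrite /s; congr (_ / _); rewrite /a3; ring.
  rewrite (_ : s ^+ 2 + _ * s - _ - x - x = x); last first.
    by apply: (eq_lin (k := -1) e); rewrite /a2; ring.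
  rewrite eqxx /=; case: eqP => // -[]; ring.
pose u := a3 / a2; have u0 : u != 0 by rewrite mulf_neq0 ?invr_eq0.
have eW : wchange u x s y W = tate_form (- (a2 / u ^+ 2)) (1 - (wa1 W + 2 * s) / u).
  rewrite /wchange /tate_form; congr Weierstrass.
  - ring.
  - by rewrite opprK.
  - rewrite opprK -/a3 /u; field; rewrite a20 a30 //.
  - apply/eqP; rewrite mulf_eq0; apply/orP; left; apply/eqP.
    rewrite (_ : _ - _ = (wa4 W - y * wa1 W + 2 * x * wa2 W + 3 * x ^+ 2) - s * a3).
      by rewrite /s divfK ?subrr.
    by rewrite /a3; ring.
  - apply/eqP; rewrite mulf_eq0; apply/orP; left; apply/eqP.
    move: hP; rewrite /= /on_curve => h; apply: (eq_lin (k := -1) h); ring.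
have eP : pchange u x s y P = Some (0, 0).
  by rewrite /= !subrr mulr0 subr0 subrr !mul0r.
have mulE (k : nat) : pchange u x s y (point_mul W k P)
    = point_mul (wchange u x s y W) k (Some (0, 0)).
  by rewrite pchange_mul // eP.
set b := - (a2 / u ^+ 2) in eW; set c := 1 - _ in eW.
have b0 : b != 0 by rewrite oppr_eq0 mulf_neq0 ?invr_eq0 ?expf_neq0.
have ord' : point_order (tate_form b c) (Some (0, 0)) 9.
  split=> // [|k hk]; rewrite -eW -mulE; first by rewrite P9.
  by have := Pn k hk; case: point_mul.
have [t [ct bt c0]] := tate_form_order9 b0 ord'.
(* The tangent at 3P in Tate's form has second coordinate -B^3 and slope -A,
   hence the sign of the scaling factor. *)
exists t, (- u); rewrite /= oppr_eq0 -ct -bt; split=> //.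
  have e1 : wa1 W = u * (1 - c) - 2 * s.
    by have := congr1 (@wa1 _) eW => /= <-; field.
  have e2 : wa2 W = u ^+ 2 * (- b) + s * wa1 W - 3 * x + s ^+ 2.
    by have := congr1 (@wa2 _) eW => /= <-; field.
  have e3 : wa3 W = u ^+ 3 * (- b) - x * wa1 W - 2 * y.
    by have := congr1 (@wa3 _) eW => /= <-; field.
  have e4 : wa4 W = s * wa3 W - 2 * x * wa2 W + (y + x * s) * wa1 W - 3 * x ^+ 2 + 2 * s * y.
    apply: (mulIf (invr_neq0 (expf_neq0 4 u0))).
    by apply: (eq_lin (k := 1) (congr1 (@wa4 _) eW)) => /=; ring.
  have e6 : wa6 W = - x * wa4 W - x ^+ 2 * wa2 W - x ^+ 3 + y * wa3 W + y ^+ 2 + x * y * wa1 W.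
    apply: (mulIf (invr_neq0 (expf_neq0 6 u0))).
    by apply: (eq_lin (k := 1) (congr1 (@wa6 _) eW)) => /=; ring.
  clearbody b c; clear - e1 e2 e3 e4 e6 ct bt.
  by rewrite /flex_form /wb2 /wb4 /wb6 e6 e4 e3 e2 e1 bt ct /A9 /B9; split; ring.
have := congr1 (@wa3 _) eW => /= e3.
apply: (mulIf (invr_neq0 (expf_neq0 3 u0))).
by apply: (eq_lin (k := 1) e3) => /=; field.
Qed.
End Order9.

(** * The Eisenstein integers *)

Section Comaximal.
Variable R : comNzRingType.
Implicit Types a b c p q : R.

(** The ideal generated by a and b is the whole ring.  Over the Eisenstein
    integers this is coprimality in the form that the descent uses. *)
Definition comaximal a b : Prop := exists u v, u * a + v * b = 1.

Lemma comaximal_sym a b : comaximal a b -> comaximal b a.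
Proof. by case=> u [v e]; exists v, u; rewrite addrC. Qed.

Lemma comaximal_mul a b c :
  comaximal a b -> comaximal a c -> comaximal a (b * c).
Proof.
case=> u [v e] [u' [v' e']].
exists (u * u' * a + u * v' * c + v * b * u'), (v * v').
by rewrite -[1]mulr1 -{1}e -e'; ring.
Qed.

Lemma comaximal_ideal a b p q k l k' l' :
  p = k * a + l * b -> q = k' * a + l' * b -> comaximal p q -> comaximal a b.
Proof.
move=> -> -> [u [v e]]; exists (u * k + v * k'), (u * l + v * l').
by rewrite -e; ring.
Qed.

Lemma comaximal_factor a b a' b' :
  comaximal (a * a') (b * b') -> comaximal a b.
Proof. by apply: (comaximal_ideal (k := a') (l := 0) (k' := 0) (l' := b')); ring. Qed.

End Comaximal.

(** The Eisenstein integers: (a, b) stands for a + b omega, where omega is a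
    primitive cube root of unity. *)
Definition eis : Type := (int * int)%type.
HB.instance Definition _ := GRing.Zmodule.on eis.

Definition eis_mul (x y : eis) : eis :=
  (x.1 * y.1 - x.2 * y.2, x.1 * y.2 + x.2 * y.1 - x.2 * y.2).

Fact eis_mulA : associative eis_mul.
Proof. by move=> x y z; rewrite /eis_mul /=; congr (_, _); ring. Qed.
Fact eis_mulC : commutative eis_mul.
Proof. by move=> x y; rewrite /eis_mul /=; congr (_, _); ring. Qed.
Fact eis_mul1 : left_id ((1, 0) : eis) eis_mul.
Proof. by move=> [a b]; rewrite /eis_mul /=; congr (_, _); ring. Qed.
Fact eis_mulDl : left_distributive eis_mul +%R.
Proof. by move=> x y z; rewrite /eis_mul /=; congr (_, _) => /=; ring. Qed.
Fact eis_1neq0 : ((1, 0) : eis) != 0.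
Proof. by []. Qed.

HB.instance Definition _ :=
  GRing.Zmodule_isComNzRing.Build eis eis_mulA eis_mulC eis_mul1 eis_mulDl eis_1neq0.

Definition omega : eis := (0, 1).
Definition lambda : eis := (1, -1).

Lemma lambdaE : lambda = 1 - omega. Proof. by []. Qed.
Lemma omega2 : omega ^+ 2 = - 1 - omega. Proof. by []. Qed.

Definition norm (x : eis) : int := x.1 ^+ 2 - x.1 * x.2 + x.2 ^+ 2.

Lemma normM x y : norm (x * y) = norm x * norm y.
Proof. by rewrite /norm /= ; ring. Qed.

Lemma norm_ge0 x : 0 <= norm x.
Proof.
have := sqr_ge0 (2 * x.1 - x.2); have := sqr_ge0 x.2; rewrite /norm; nra.
Qed.

Lemma norm_eq0 x : (norm x == 0) = (x == 0).
Proof.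
case: x => a b; apply/eqP/eqP => [|[-> ->]] //; rewrite /norm /= => h.
have h1 := sqr_ge0 (2 * a - b); have h2 := sqr_ge0 (2 * b - a).
have -> : a = 0 by nia.
by have -> : b = 0 by nia.
Qed.

Lemma eis_mulf_eq0 (x y : eis) : (x * y == 0) = (x == 0) || (y == 0).
Proof. by rewrite -!norm_eq0 normM mulf_eq0. Qed.

Lemma eis_mulI (x y z : eis) : x != 0 -> x * y = x * z -> y = z.
Proof.
move=> x0 e; apply/subr0_eq/eqP; have := eis_mulf_eq0 x (y - z).
by rewrite mulrBr e subrr eqxx (negbTE x0).
Qed.

Definition eis_unit (x : eis) : Prop := exists y, x * y = 1.

Lemma eis_unitM x y : eis_unit x -> eis_unit y -> eis_unit (x * y).
Proof. by move=> [u e] [v e']; exists (u * v); rewrite -[1]mulr1 -{1}e -e'; ring. Qed.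

Lemma eis_unit_norm x : eis_unit x -> norm x = 1.
Proof.
case=> y e; have := congr1 norm e; rewrite normM (_ : norm 1 = 1) //.
move: (norm_ge0 x) (norm_ge0 y); move: (norm x) (norm y) => m n hm hn hmn.
have m0 : m != 0 by apply/eqP => m0; rewrite m0 mul0r in hmn.
have n0 : n != 0 by apply/eqP => n0; rewrite n0 mulr0 in hmn.
have {}hm : 0 <= m - 1 by lia.
have {}hn : 0 <= n - 1 by lia.
have := mulr_ge0 hm hn; nia.
Qed.

Lemma eis_unit_cases x : eis_unit x ->
  [\/ x = 1 \/ x = -1, x = omega \/ x = - omega | x = 1 + omega \/ x = - (1 + omega)].
Proof.
move/eis_unit_norm; case: x => a b; rewrite /norm /= => h.
have ha : -1 <= a <= 1 by nia.
have hb : -1 <= b <= 1 by nia.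
have {}ha : a = -1 \/ a = 0 \/ a = 1 by lia.
have {}hb : b = -1 \/ b = 0 \/ b = 1 by lia.
case: ha h => [->|[->|->]]; case: hb => [->|[->|->]] h //.
all: try by constructor 1; auto.
all: try by constructor 2; auto.
all: by constructor 3; auto.
Qed.

(** * Euclidean division and the prime 1 - omega *)

Definition eis_conj (x : eis) : eis := (x.1 - x.2, - x.2).

Lemma round_div (m n : int) : 0 < n ->
  exists q : int, `|2 * (m - q * n)| <= n.
Proof.
move=> n0; exists ((2 * m + n) %/ (2 * n))%Z.
have := divz_eq (2 * m + n) (2 * n).
have := modz_ge0 (2 * m + n) (d := 2 * n); have := ltz_pmod (2 * m + n) (d := 2 * n).
move: (_ %/ _)%Z (_ %% _)%Z => q r; lia.
Qed.

(** Rounding the coordinates of a / b leaves an error with coordinates at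
    most 1/2 in absolute value, hence of norm at most 3/4. *)
Lemma eis_division (a b : eis) : b != 0 -> exists q, norm (a - q * b) < norm b.
Proof.
move=> b0; have n0 : 0 < norm b by rewrite lt_neqAle norm_ge0 andbT eq_sym norm_eq0.
set c := a * eis_conj b.
have [q1 h1] := round_div c.1 n0; have [q2 h2] := round_div c.2 n0.
pose q : eis := (q1, q2); exists q; rewrite -(ltr_pM2r n0).
have ec : norm (eis_conj b) = norm b by rewrite /norm /=; ring.
have -> : norm (a - q * b) * norm b
  = norm (c.1 - q1 * norm b, c.2 - q2 * norm b).
  by rewrite -{1}ec -normM; congr norm; rewrite /c /norm /=; congr (_, _) => /=; ring.
move: h1 h2; rewrite /norm /= -/(norm b); move: (norm b) n0 => N n0.
move: (c.1 - _) (c.2 - _) => x y hx hy.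
suff : 4 * (x ^+ 2 - x * y + y ^+ 2) <= 3 * N * N by nia.
have hx1 : 0 <= N - 2 * x by lia.
have hx2 : 0 <= N + 2 * x by lia.
have hy1 : 0 <= N - 2 * y by lia.
have hy2 : 0 <= N + 2 * y by lia.
have := mulr_ge0 hx1 hx2; have := mulr_ge0 hy1 hy2.
have := mulr_ge0 hx1 hy1; have := mulr_ge0 hx2 hy2;
have := mulr_ge0 hx1 hy2; have := mulr_ge0 hx2 hy1; nia.
Qed.

Lemma eis_bezout (a b : eis) :
  exists g u v a' b', [/\ g = u * a + v * b, a = g * a' & b = g * b'].
Proof.
have [n hn] := ubnP `|norm b|%N; elim: n a b hn => // n IH a b hn.
have [->|b0] := eqVneq b 0.
  by exists a, 1, 0, 1, 0; split; ring.
have [q hq] := eis_division a b0.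
have [|g [u [v [b' [r' [eg eb er]]]]]] := IH b (a - q * b).
  by have := norm_ge0 (a - q * b); lia.
exists g, v, (u - v * q), (r' + q * b'), b'; split=> //; first by rewrite eg; ring.
by rewrite mulrDr -er mulrCA -eb; ring.
Qed.

(** If a b is a unit times c^3 with a and b comaximal, then (a, c)^3 is the
    ideal a (a^2, a c, c^2, b) = (a), because (a^2, b) is the unit ideal.  So a is
    associated to g^3, where g is a generator of (a, c). *)
Lemma eis_cube_factor (a b c e : eis) : a != 0 ->
  comaximal a b -> eis_unit e -> a * b = e * c ^+ 3 ->
  exists e' g, eis_unit e' /\ a = e' * g ^+ 3.
Proof.
move=> a0 [k [l cop]] [e1 he] eab.
have [g [u [v [a' [c' [eg ea ec]]]]]] := eis_bezout a c.
have ec3 : c ^+ 3 = e1 * a * b by rewrite -mulrA eab mulrA (mulrC e1) he mul1r.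
pose s := u ^+ 3 * a ^+ 2 + 3 * u ^+ 2 * a * v * c + 3 * u * v ^+ 2 * c ^+ 2
  + v ^+ 3 * e1 * b.
pose t := k ^+ 2 * a' ^+ 3 + (2 * k * l * a + l ^+ 2 * b) * e * c' ^+ 3.
have gs : g ^+ 3 = a * s.
  by rewrite eg; apply: (eq_lin (k := v ^+ 3) ec3); rewrite /s; ring.
have at_ : a = t * g ^+ 3.
  have ea3 : a ^+ 3 = g ^+ 3 * a' ^+ 3 by rewrite {1}ea exprMn.
  have ecc : a * b = e * (g ^+ 3 * c' ^+ 3) by rewrite eab ec exprMn.
  have cop2 : (k * a + l * b) ^+ 2 * a = a by rewrite cop expr1n mul1r.
  rewrite -[LHS]cop2.
  apply: (eq_lin2 (k := k ^+ 2) (k' := 2 * k * l * a + l ^+ 2 * b) ea3 ecc).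
  by rewrite /t; ring.
exists t, g; split=> //; exists s; apply: (eis_mulI a0).
by rewrite mulr1 {2}at_ gs; ring.
Qed.

(** Divisibility by the prime lambda = 1 - omega above 3.  The residue field
    is F_3 and omega reduces to 1, so it is read on the sum of the coordinates. *)
Definition lambda_dvd (x : eis) : bool := (3 %| x.1 + x.2)%Z.

Lemma lambda_mul k : lambda * k = (k.1 + k.2, 2 * k.2 - k.1).
Proof.
by case: k => a b; congr (_, _); rewrite /= !mul1r !mulN1r opprK //; ring.
Qed.

Lemma lambda_dvdP x : reflect (exists k, x = lambda * k) (lambda_dvd x).
Proof.
apply: (iffP idP) => [/dvdzP[q e]|[k ->]]; last first.
  apply/dvdzP; exists k.2; rewrite lambda_mul /=; ring.
exists (x.1 - q, q); rewrite lambda_mul; case: x e => a b /= e.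
by congr (_, _); [ring | apply: (eq_lin (k := 1) e); ring].
Qed.

Lemma mod_lambda_cases x : exists k, [\/ x = lambda * k, x = lambda * k + 1 | x = lambda * k - 1].
Proof.
have [k [s [e hs]]] : exists k s, x.1 + x.2 = 3 * k + s /\ (s = 0 \/ s = 1 \/ s = -1).
  exists ((x.1 + x.2 + 1)%R %/ 3)%Z, (((x.1 + x.2 + 1)%R %% 3)%Z - 1).
  split; lia.
exists (x.1 - s - k, k); rewrite lambda_mul; case: x e => a b /= e.
by case: hs e => [->|[->|->]] e; [constructor 1|constructor 2|constructor 3];
   congr (_, _) => /=; first [ring | apply: (eq_lin (k := 1) e) => /=; ring].
Qed.

Lemma dvd3M (x y : int) : (3 %| x * y)%Z = (3 %| x)%Z || (3 %| y)%Z.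
Proof. by rewrite !dvdzE abszM Euclid_dvdM. Qed.

Lemma lambda_dvdM x y : lambda_dvd (x * y) = lambda_dvd x || lambda_dvd y.
Proof.
rewrite /lambda_dvd -dvd3M /=.
have -> : (x.1 * y.1 - x.2 * y.2) + (x.1 * y.2 + x.2 * y.1 - x.2 * y.2)
  = (x.1 + x.2) * (y.1 + y.2) + (- (x.2 * y.2)) * 3 by ring.
by rewrite rpredDr //; apply: dvdz_mull.
Qed.

Lemma lambda_dvdX3 x : lambda_dvd (x ^+ 3) = lambda_dvd x.
Proof. by rewrite !exprS expr0 mulr1 !lambda_dvdM !orbb. Qed.

Lemma lambda_dvdD x y : lambda_dvd y -> lambda_dvd (x + y) = lambda_dvd x.
Proof.
move=> /lambda_dvdP[k ->]; apply/lambda_dvdP/lambda_dvdP => -[j e]; last first.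
  by exists (j + k); rewrite e; ring.
by exists (j - k); rewrite mulrBr -e; ring.
Qed.

(** For x = s + lambda k with s = 1 or -1, one finds
    x^3 - s = -9 omega (k + s k^2) + lambda^3 (k^3 - k).  The residue field has
    three elements, so k^3 - k is divisible by lambda; and lambda^4 is
    9 omega^2. *)
Lemma cube_mod9 x : ~~ lambda_dvd x -> exists k, x ^+ 3 = 9 * k + 1 \/ x ^+ 3 = 9 * k - 1.
Proof.
move=> nx.
have red (k : eis) : exists j, k - k ^+ 3 = lambda * j.
  have [j [] ->] := mod_lambda_cases k.
  - by exists (j - lambda ^+ 2 * j ^+ 3); ring.
  - by exists (- 2 * j - lambda ^+ 2 * j ^+ 3 - 3 * lambda * j ^+ 2); ring.
  - by exists (- 2 * j - lambda ^+ 2 * j ^+ 3 + 3 * lambda * j ^+ 2); ring.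
have cube (s k : eis) : s ^+ 2 = 1 -> exists j, (lambda * k + s) ^+ 3 = 9 * j + s.
  move=> s2; have [j hj] := red k.
  exists (- omega * k - omega * s * k ^+ 2 - omega ^+ 2 * j).
  apply: (eq_lin2 (k := - lambda ^+ 3) (k' := 3 * lambda * k + s) hj s2).
  rewrite lambdaE; ring: omega2.
have [k hk] := mod_lambda_cases x; case: hk => ex.
- by case/lambda_dvdP: nx; exists k.
- by have [|j hj] := cube 1 k; [rewrite expr1n | exists j; left; rewrite ex].
- by have [|j hj] := cube (- 1) k; [rewrite sqrrN expr1n | exists j; right; rewrite ex].
Qed.

(** * Fermat's equation of degree 3 over the Eisenstein integers *)

Lemma norm_lambda : norm lambda = 3. Proof. by []. Qed.

Lemma normX3 (x : eis) : norm (x ^+ 3) = norm x ^+ 3.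
Proof. by rewrite !exprS !expr0 !mulr1 !normM. Qed.

Lemma norm_gt0 x : (0 < norm x) = (x != 0).
Proof. by rewrite lt_neqAle norm_ge0 andbT eq_sym norm_eq0. Qed.

Lemma omega_unit : eis_unit omega.
Proof. by exists (omega ^+ 2). Qed.

Lemma comaximal_lambda (x y : eis) : comaximal x y -> lambda_dvd x -> ~~ lambda_dvd y.
Proof.
case=> u [v e] hx; apply/negP => hy.
have : lambda_dvd (u * x + v * y) by rewrite lambda_dvdD ?lambda_dvdM ?hx ?hy orbT.
by rewrite e.
Qed.

Lemma cube_sum_mod9 (p q : eis) : ~~ lambda_dvd p -> ~~ lambda_dvd q -> lambda_dvd (p ^+ 3 + q ^+ 3) ->
  exists k, p ^+ 3 + q ^+ 3 = 9 * k.
Proof.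
move=> /cube_mod9[k hk] /cube_mod9[l hl].
have l9 (m s : eis) : lambda_dvd (9 * m + s) = lambda_dvd s by rewrite addrC lambda_dvdD // lambda_dvdM.
case: hk => ->; case: hl => ->.
- by rewrite (_ : _ + _ = 9 * (k + l) + 2) ?l9 //; ring.
- by move=> _; exists (k + l); ring.
- by move=> _; exists (k + l); ring.
- by rewrite (_ : _ + _ = 9 * (k + l) + - 2) ?l9 //; ring.
Qed.

(** The six units are pairwise incongruent modulo 3. *)
Lemma unit_mod3 (e s : eis) : eis_unit e -> s = 1 \/ s = -1 ->
  (exists k, s - e = 3 * k) -> e = s.
Proof.
move=> /eis_unit_cases he hs [[k1 k2]] /(congr1 (fun z : eis => (z.1, z.2))) /= [].
by case: hs => ->; case: he => -[->|->] //= h1 h2; exfalso; lia.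
Qed.

(** One step of the descent.  Since lambda divides x and 9 divides
    p^3 + q^3 = e x^3, lambda^2 divides x.  The three factors p + q, p + omega q
    and p + omega^2 q are lambda a, lambda b, lambda c, where a, b, c are
    pairwise comaximal with a linear relation whose coefficients are units, and
    a b c = e (x / lambda)^3.  So a, b, c are cubes up to units, and the new
    solution has the norm of x / lambda. *)
Lemma eis_descent_step (p q x e : eis) : p != 0 -> q != 0 -> x != 0 ->
  eis_unit e -> comaximal p q ->
  lambda_dvd x -> ~~ lambda_dvd p -> ~~ lambda_dvd q -> p ^+ 3 + q ^+ 3 = e * x ^+ 3 ->
  exists a b c u v w, [/\ [/\ eis_unit u, eis_unit v & eis_unit w],
    [/\ comaximal a b, comaximal a c & comaximal b c],
    u * a ^+ 3 + v * b ^+ 3 + w * c ^+ 3 = 0,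
    a * b * c != 0 /\ lambda_dvd (a * b * c) & norm (a * b * c) < norm x].
Proof.
move=> p0 q0 x0 he cop lx lp lq E.
have lsum : lambda_dvd (p ^+ 3 + q ^+ 3) by rewrite E lambda_dvdM lambda_dvdX3 lx orbT.
have [y ey] := lambda_dvdP _ lx.
have l0 : lambda != 0 by [].
have y0 : y != 0 by move: x0; rewrite ey eis_mulf_eq0 => /norP[].
have ly : lambda_dvd y.
  have [k hk] := cube_sum_mod9 lp lq lsum.
  have [f hf] := he.
  rewrite -lambda_dvdX3; apply/lambda_dvdP; exists (omega * f * k).
  apply: (eis_mulI (x := lambda ^+ 3)) => //.
  apply: (eq_lin2 (k := f) (k' := - lambda ^+ 3 * y ^+ 3) (etrans (esym E) hk) hf).
  by rewrite ey (_ : 9 = lambda ^+ 4 * omega) //; ring.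
have lpq : lambda_dvd (p + q).
  rewrite -lambda_dvdX3 (_ : _ ^+ 3 = p ^+ 3 + q ^+ 3 + 3 * (p * q * (p + q))); last by ring.
  by rewrite lambda_dvdD // lambda_dvdM.
have [a ea] := lambda_dvdP _ lpq.
pose b := a - q; pose c := a - (1 + omega) * q.
have pE : p = (1 - omega) * a - q by rewrite -lambdaE -ea; ring.
have abc : a * b * c = e * y ^+ 3.
  apply: (eis_mulI (x := lambda ^+ 3)) => //.
  transitivity (p ^+ 3 + q ^+ 3); last by rewrite E ey; ring.
  by rewrite pE /b /c lambdaE; ring: omega2.
have rel : omega * a + omega ^+ 2 * b + c = 0 by rewrite /b /c; ring: omega2.
have cab : comaximal a b.
  apply: (comaximal_ideal (k := - omega) (l := 1) (k' := 1) (l' := -1) _ _ cop).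
    by rewrite /b pE; ring.
  by rewrite /b; ring.
have cac : comaximal a c.
  apply: (comaximal_ideal (k := 1) (l := 0) (k' := - omega ^+ 2) (l' := - omega) _ _ cab); first by ring.
  by apply: (eq_lin (k := omega) rel); rewrite /b /c; ring: omega2.
have cbc : comaximal b c.
  apply: (comaximal_ideal (k := - omega) (l := - omega ^+ 2) (k' := 1) (l' := 0) _ _ cab); last by ring.
  by apply: (eq_lin (k := omega ^+ 2) rel); rewrite /b /c; ring: omega2.
have abc0 : a * b * c != 0.
  rewrite abc !exprS expr0 mulr1 !eis_mulf_eq0 (negbTE y0) orbF.
  by rewrite -norm_eq0 (eis_unit_norm he).
move: (abc0); rewrite !eis_mulf_eq0 !negb_or -andbA => /and3P[a0 b0 c0].
have [u [a1 [hu ea1]]] := eis_cube_factor a0 (comaximal_mul cab cac) he (etrans (mulrA _ _ _) abc).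
have [v [b1 [hv eb1]]] : exists v b1, eis_unit v /\ b = v * b1 ^+ 3.
  apply: (eis_cube_factor (c := y) b0 (comaximal_mul (comaximal_sym cab) cbc) he).
  by rewrite -abc; ring.
have [w [c1 [hw ec1]]] : exists w c1, eis_unit w /\ c = w * c1 ^+ 3.
  apply: (eis_cube_factor (c := y) c0 (comaximal_mul (comaximal_sym cac) (comaximal_sym cbc)) he).
  by rewrite -abc; ring.
have cub (f g z : eis) : f = g * z ^+ 3 -> f = z * (g * z ^+ 2) by move=> ->; ring.
have abcE : a * b * c = (u * v * w) * (a1 * b1 * c1) ^+ 3 by rewrite ea1 eb1 ec1; ring.
exists a1, b1, c1, (omega * u), (omega ^+ 2 * v), w; split.
- by split=> //; do ?apply: eis_unitM => //; apply: omega_unit.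
- move: cab cac cbc; rewrite (cub _ _ _ ea1) (cub _ _ _ eb1) (cub _ _ _ ec1).
  by split; apply: comaximal_factor; eassumption.
- by rewrite -rel ea1 eb1 ec1; ring.
- split; first by apply: contra_neq abc0; rewrite abcE => ->; rewrite expr0n mulr0.
  have : lambda_dvd (a * b * c) by rewrite abc lambda_dvdM lambda_dvdX3 ly orbT.
  rewrite abcE lambda_dvdM lambda_dvdX3; case/orP => // /lambda_dvdP[k hk].
  have := eis_unit_norm (eis_unitM (eis_unitM hu hv) hw).
  by rewrite hk normM norm_lambda; move: (norm k) => nk; clear; lia.
have nabc : norm (a1 * b1 * c1) ^+ 3 = norm y ^+ 3.
  have := congr1 norm (etrans (esym abcE) abc).
  rewrite normM (eis_unit_norm (eis_unitM (eis_unitM hu hv) hw)) mul1r.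
  by rewrite normM (eis_unit_norm he) mul1r !normX3.
have /eqP : norm (a1 * b1 * c1) = norm y.
  by apply: (pexpIrn (n := 3)) => //; rewrite ?nnegrE ?norm_ge0.
move/eqP=> ->; rewrite ey normM norm_lambda.
by rewrite ltr_pMl // norm_gt0.
Qed.

(** Dividing by v and putting the variable divisible by lambda on the right,
    the equation takes the form of [eis_descent_step], because the ratio w / v is
    a sign, which is its own cube.  The induction is on the norm of a b c. *)
Lemma eis_descent (n : nat) (a b c u v w : eis) :
  eis_unit u -> eis_unit v -> eis_unit w ->
  comaximal a b -> comaximal a c -> comaximal b c ->
  u * a ^+ 3 + v * b ^+ 3 + w * c ^+ 3 = 0 ->
  a * b * c != 0 -> lambda_dvd (a * b * c) -> norm (a * b * c) < n%:Z -> False.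
Proof.
elim: n a b c u v w => [|n IH] a b c u v w hu hv hw cab cac cbc E.
  by rewrite ltNge norm_ge0.
wlog la : a b c u v w hu hv hw cab cac cbc E / lambda_dvd a => [W|] h0 hl hn.
  move: (hl); rewrite !lambda_dvdM -orbA => /or3P[] l.
  - exact: (W a b c u v w).
  - apply: (W b a c v u w) => //; first exact: comaximal_sym.
    + by rewrite -E; ring.
    + by rewrite (mulrC b).
    + by rewrite (mulrC b).
    + by rewrite (mulrC b).
  - have p : c * a * b = a * b * c by ring.
    apply: (W c a b w u v) => //; rewrite ?p //; try exact: comaximal_sym.
    by rewrite -E; ring.
have lb : ~~ lambda_dvd b by apply: comaximal_lambda cab la.
have lc : ~~ lambda_dvd c by apply: comaximal_lambda cac la.
move: (h0); rewrite !eis_mulf_eq0 !negb_or -andbA => /and3P[a0 b0 c0].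
have [v' hv'] := hv; have [w' hw'] := hw.
(* Cubes prime to lambda are congruent to 1 or -1 modulo 9 and lambda^3 is
   divisible by 3, so that w / v is congruent to a sign modulo 3. *)
have [s [hs es]] : exists s : eis, (s = 1 \/ s = -1) /\ w * v' = s.
  have [k hk] := cube_mod9 lb; have [l hl'] := cube_mod9 lc.
  have [y ey] := lambda_dvdP _ la.
  have l3 : lambda ^+ 3 = 3 * (- omega * lambda) by [].
  have huw : eis_unit (w * v') by exists (w' * v); rewrite mulrACA hw' mul1r mulrC.
  have e3 : b ^+ 3 + (w * v') * c ^+ 3 = 3 * (u * v' * omega * lambda * y ^+ 3).
    apply: (eq_lin2 (k := v') (k' := - b ^+ 3) E hv').
    by rewrite ey exprMn l3; ring.
  have [s1 [hs1 [k1 hk1]]] : exists s1 : eis, (s1 = 1 \/ s1 = -1) /\ exists k1, b ^+ 3 = 3 * k1 + s1.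
    by case: hk => ->; [exists 1 | exists (-1)]; split; auto; exists (3 * k); ring.
  have [s2 [hs2 [k2 hk2]]] : exists s2 : eis, (s2 = 1 \/ s2 = -1) /\ exists k2, c ^+ 3 = 3 * k2 + s2.
    by case: hl' => ->; [exists 1 | exists (-1)]; split; auto; exists (3 * l); ring.
  have hs : (- s1 * s2 = 1 \/ - s1 * s2 = -1).
    by case: hs1 => ->; case: hs2 => ->; [right|left|left|right]; ring.
  exists (- s1 * s2); split => //; apply: unit_mod3 => //.
  have q2 : s2 ^+ 2 = 1 by case: hs2 => ->; ring.
  exists (s2 * (k1 + (w * v') * k2 - u * v' * omega * lambda * y ^+ 3)).
  rewrite hk1 hk2 in e3.
  by apply: (eq_lin2 (k := - s2) (k' := w * v') e3 q2); ring.
have s3 : s ^+ 3 = s by case: hs => ->; ring.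
have s0 : s != 0 by case: hs => ->.
have nlsc : ~~ lambda_dvd (s * c) by rewrite lambda_dvdM negb_or lc andbT; case: hs => ->.
have sc0 : s * c != 0 by rewrite eis_mulf_eq0 negb_or s0.
have huv : eis_unit (- (u * v')).
  have [u' hu'] := hu; exists (- (u' * v)).
  by rewrite mulrNN mulrACA hu' mul1r mulrC.
have cbs : comaximal b (s * c).
  by apply: comaximal_mul => //; case: hs => ->; exists 0; [exists 1 | exists (-1)]; ring.
have Es : b ^+ 3 + (s * c) ^+ 3 = - (u * v') * a ^+ 3.
  rewrite exprMn s3 -es.
  by apply: (eq_lin2 (k := v') (k' := - b ^+ 3) E hv'); ring.
have [a1 [b1 [c1 [u1 [v1 [w1 [[? ? ?] [? ? ?] ? [? ?] hn1]]]]]]] :=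
  eis_descent_step b0 sc0 a0 huv cbs la lb nlsc Es.
apply: (IH a1 b1 c1 u1 v1 w1) => //; apply: (lt_le_trans hn1).
have nb : 0 < norm (b * c) by rewrite norm_gt0 eis_mulf_eq0 negb_or b0 c0.
move: hn (norm_ge0 a); rewrite -mulrA normM.
by move: (norm a) (norm (b * c)) nb => i j; clear; nia.
Qed.

(** After division by the greatest common divisor, x, y and z are pairwise
    comaximal.  If lambda divides one of them the descent applies; otherwise
    three cubes congruent to 1 or -1 modulo 9 would have sum 0. *)
Theorem eis_fermat3 (x y z : eis) : x ^+ 3 + y ^+ 3 + z ^+ 3 = 0 -> x * y * z = 0.
Proof.
move=> E; apply/eqP/negPn/negP => h0.
have [g1 [k [l [x1 [y1 [eg1 ex1 ey1]]]]]] := eis_bezout x y.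
have [g [k' [l' [g2 [z2 [eg eg2 ez2]]]]]] := eis_bezout g1 z.
move: h0; rewrite ex1 ey1 eg2 ez2 => h0.
have g0 : g != 0 by apply: contra_neq h0 => ->; rewrite !mul0r.
pose x2 := g2 * x1; pose y2 := g2 * y1.
have E2 : x2 ^+ 3 + y2 ^+ 3 + z2 ^+ 3 = 0.
  apply: (eis_mulI g0); apply: (eis_mulI g0); apply: (eis_mulI g0).
  by rewrite !mulr0 -E ex1 ey1 eg2 ez2 /x2 /y2; ring.
have co : (k' * k) * x2 + (k' * l) * y2 + l' * z2 = 1.
  apply: (eis_mulI g0); rewrite mulr1 [RHS]eg.
  have exx : x = g * x2 by rewrite ex1 eg2 mulrA.
  have eyy : y = g * y2 by rewrite ey1 eg2 mulrA.
  by rewrite eg1 exx eyy [in LHS]mulrDr [in RHS]ez2; ring.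
have cop (p q r a b c : eis) : p ^+ 3 + q ^+ 3 + r ^+ 3 = 0 ->
    a * p + b * q + c * r = 1 -> comaximal p q.
  (* r^3 lies in the ideal (p, q), which therefore contains the cube of
     a p + b q + c r = 1. *)
  move=> e3 e1; pose s := 1 + c * r + (c * r) ^+ 2.
  exists (s * a - c ^+ 3 * p ^+ 2), (s * b - c ^+ 3 * q ^+ 2).
  by apply: (eq_lin2 (k := - c ^+ 3) (k' := s) e3 e1); rewrite /s; ring.
have cxy : comaximal x2 y2 by apply: cop E2 co.
have cxz : comaximal x2 z2.
  apply: (cop x2 z2 y2 (k' * k) l' (k' * l)); first by rewrite -E2; ring.
  by rewrite -co; ring.
have cyz : comaximal y2 z2.
  apply: (cop y2 z2 x2 (k' * l) l' (k' * k)); first by rewrite -E2; ring.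
  by rewrite -co; ring.
have h2 : x2 * y2 * z2 != 0.
  apply: contra_neq h0 => e; transitivity (g ^+ 3 * (x2 * y2 * z2)).
    by rewrite /x2 /y2; ring.
  by rewrite e mulr0.
clearbody x2 y2.
have u1 : eis_unit 1 by exists 1; rewrite mulr1.
case l2 : (lambda_dvd (x2 * y2 * z2)).
  apply: (eis_descent (n := `|norm (x2 * y2 * z2)|.+1) u1 u1 u1 cxy cxz cyz) => //.
    by rewrite !mul1r.
  by move: (norm_ge0 (x2 * y2 * z2)); move: (norm _) => i; clear; lia.
move: l2; rewrite !lambda_dvdM => /negbT; rewrite !negb_or -andbA => /and3P[nx ny nz].
have [i hi] := cube_mod9 nx; have [j hj] := cube_mod9 ny; have [m hm] := cube_mod9 nz.
have {hi hj hm}[s [n [hs hn]]] : exists (s : int) (n : eis),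
   (s = 1 \/ s = -1 \/ s = 3 \/ s = -3) /\ 9 * n + ((s, 0) : eis) = 0.
  case: hi E2 => ->; case: hj => ->; case: hm => -> E2.
  - by exists 3, (i + j + m); split; [lia | rewrite (_ : ((3, 0) : eis) = 3) // -[RHS]E2; ring].
  - by exists 1, (i + j + m); split; [lia | rewrite (_ : ((1, 0) : eis) = 1) // -[RHS]E2; ring].
  - by exists 1, (i + j + m); split; [lia | rewrite (_ : ((1, 0) : eis) = 1) // -[RHS]E2; ring].
  - by exists (-1), (i + j + m); split; [lia | rewrite (_ : ((-1, 0) : eis) = -1) // -[RHS]E2; ring].
  - by exists 1, (i + j + m); split; [lia | rewrite (_ : ((1, 0) : eis) = 1) // -[RHS]E2; ring].
  - by exists (-1), (i + j + m); split; [lia | rewrite (_ : ((-1, 0) : eis) = -1) // -[RHS]E2; ring].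
  - by exists (-1), (i + j + m); split; [lia | rewrite (_ : ((-1, 0) : eis) = -1) // -[RHS]E2; ring].
  - by exists (-3), (i + j + m); split; [lia | rewrite (_ : ((-3, 0) : eis) = -3) // -[RHS]E2; ring].
have := congr1 (fun z : eis => z.1) hn => /=; move: hs; clear; lia.
Qed.

(** * Fermat's equation and a cyclic cubic over a quadratic field *)

Lemma rmorph_A9 (R S : pzRingType) (f : {rmorphism R -> S}) t : f (A9 t) = A9 (f t).
Proof. by rewrite /A9 rmorphD rmorphB rmorphM !rmorphXn rmorph_nat rmorph1. Qed.

Lemma rmorph_B9 (R S : pzRingType) (f : {rmorphism R -> S}) t : f (B9 t) = B9 (f t).
Proof. by rewrite /B9 rmorphM rmorphB rmorph1. Qed.

Section QuadraticField.
Variable K : fieldType.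
Variable f : {rmorphism rat -> K}.
Variable sigma : {rmorphism K -> K}.
Hypothesis sigma_fixed : forall x, sigma x = x -> exists q : rat, x = f q.

Hypothesis sigmaK : involutive sigma.

Lemma natK_neq0 n : (n.+1%:R : K) != 0.
Proof.
have := fmorph_eq0 f (n.+1%:R); rewrite rmorph_nat => ->.
by rewrite pnatr_eq0.
Qed.

Lemma sigma_rat q : sigma (f q) = f q.
Proof.
have h (i : int) : sigma (f i%:~R) = f i%:~R by rewrite !rmorph_int.
by rewrite -(divq_num_den q) !fmorph_div !h.
Qed.

Section CubeRoot.
Variable w : K.
Hypothesis w2 : w ^+ 2 = - 1 - w.

Lemma w_irrational : sigma w != w.
Proof.
apply/eqP => /sigma_fixed[q e].
have : f (q ^+ 2 + q + 1) = 0.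
    by rewrite !rmorphD rmorphXn rmorph1 -e w2; ring.
move/eqP; rewrite fmorph_eq0 => /eqP h.
have := sqr_ge0 (2 * q + 1); lra.
Qed.

(** The embedding of the Eisenstein integers given by the choice of a cube
    root of unity w in K. *)
Definition iota (x : eis) : K := x.1%:~R + x.2%:~R * w.

Lemma iotaD x y : iota (x + y) = iota x + iota y.
Proof. by rewrite /iota /= !rmorphD /=; ring. Qed.

Lemma iotaM x y : iota (x * y) = iota x * iota y.
Proof.
rewrite /iota /= !rmorphB rmorphD /= !rmorphM /=.
by ring: w2.
Qed.

Lemma iotaX x n : iota (x ^+ n) = iota x ^+ n.
Proof.
elim: n => [|n IH]; last by rewrite !exprS iotaM IH.
by rewrite !expr0 /iota /= mul0r addr0.
Qed.

Lemma iota_eq0 x : iota x = 0 -> x = 0.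
Proof.
move=> e; apply/eqP; rewrite -norm_eq0.
have : iota x * iota (eis_conj x) = (norm x)%:~R.
  rewrite /iota /norm /eis_conj /= !rmorphD !rmorphN !rmorphM.
  by ring: w2.
rewrite e mul0r => /esym/eqP; rewrite -(rmorph_int f) fmorph_eq0.
by rewrite intr_eq0.
Qed.

Lemma iota_fraction x : exists (D : int) (X : eis), D != 0 /\ D%:~R * x = iota X.
Proof.
have d : w - sigma w != 0 by rewrite subr_eq0 eq_sym w_irrational.
have sd : sigma (w - sigma w) = - (w - sigma w) by rewrite rmorphB sigmaK opprB.
have [b hb] : exists b, (x - sigma x) / (w - sigma w) = f b.
  apply: sigma_fixed; rewrite fmorph_div rmorphB sigmaK sd.
  by rewrite -opprB invrN mulrNN.
have [a ha] : exists a, x - f b * w = f a.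
  apply: sigma_fixed; rewrite rmorphB rmorphM sigma_rat -hb.
  apply: (mulfI d); apply: subr0_eq; field; exact: d.
have xE : x = f a + f b * w by rewrite -ha subrK.
exists (denq a * denq b), (numq a * denq b, numq b * denq a); split.
  by rewrite mulf_neq0 // denq_eq0.
have num (q : rat) : (denq q)%:~R * f q = (numq q)%:~R.
  by rewrite -(rmorph_int f (denq q)) -rmorphM -(rmorph_int f (numq q)) numqE mulrC.
rewrite /iota /= !rmorphM /= -!num xE; ring.
Qed.

(** Since w is not rational, K = Q(w) is the field of fractions of the
    Eisenstein integers, and [eis_fermat3] extends to K by homogeneity. *)
Lemma quadratic_fermat3 (x y z : K) : x ^+ 3 + y ^+ 3 + z ^+ 3 = 0 -> x * y * z = 0.
Proof.
have [D [X [D0 eX]]] := iota_fraction x.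
have [D' [Y [D'0 eY]]] := iota_fraction y.
have [D'' [Z [D''0 eZ]]] := iota_fraction z.
have intK (i : int) : i != 0 -> (i%:~R : K) != 0.
  by move=> i0; rewrite -(rmorph_int f) fmorph_eq0 intr_eq0.
have iota_int (i : int) : iota ((i, 0) : eis) = i%:~R.
  by rewrite /iota /= mul0r addr0.
move: (intK _ D0) (intK _ D'0) (intK _ D''0) => {}D0 {}D'0 {}D''0 E.
pose X' := ((D' * D'', 0) : eis) * X; pose Y' := ((D * D'', 0) : eis) * Y.
pose Z' := ((D * D', 0) : eis) * Z; set P : K := D%:~R * D'%:~R * D''%:~R.
have eX' : iota X' = P * x by rewrite iotaM iota_int -eX rmorphM /P; ring.
have eY' : iota Y' = P * y by rewrite iotaM iota_int -eY rmorphM /P; ring.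
have eZ' : iota Z' = P * z by rewrite iotaM iota_int -eZ rmorphM /P; ring.
clearbody X' Y' Z'.
have /iota_eq0 /eis_fermat3 : iota (X' ^+ 3 + Y' ^+ 3 + Z' ^+ 3) = 0.
  rewrite !iotaD !iotaX eX' eY' eZ' !exprMn -!mulrDr E; exact: mulr0.
move/(congr1 iota); rewrite !iotaM eX' eY' eZ' [iota 0]/iota /= mul0r addr0.
have P0 : P != 0 by rewrite !mulf_neq0.
move=> e; apply: (mulfI (expf_neq0 3 P0)); apply: (eq_lin (k := 1) e); ring.
Qed.

End CubeRoot.

(** The conjugate of t is another root, so that the third root r is
    rational.  The three roots are r, 1 / (1 - r) and 1 - 1/r, the orbit of r
    under the diamond operators of X_1(9), hence t is rational too. *)
Lemma cyclic_cubic_root (t : K) (s : rat) :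
  A9 t = f s * B9 t -> exists t0 : rat, t = f t0.
Proof.
move=> E; have Es : A9 (sigma t) = f s * B9 (sigma t).
  by have := congr1 sigma E; rewrite rmorphM sigma_rat rmorph_A9 rmorph_B9.
have [/sigma_fixed //|ne] := eqVneq (sigma t) t.
have d : t - sigma t != 0 by rewrite subr_eq0 eq_sym.
set t' := sigma t in Es ne d *.
have [e1 he1] : exists q, t + t' = f q.
  by apply: sigma_fixed; rewrite rmorphD /= sigmaK addrC.
(* The roots sum to 3 + s, which gives the third one. *)
pose r := 3 + s - e1.
have fr : f r = 3 + f s - (t + t') by rewrite he1 /r !rmorphB rmorphD rmorph_nat.
have sE : (t ^+ 2 + t * t' + t' ^+ 2) - 3 * (t + t') = f s * (t + t' - 1).
  apply: (mulfI d); apply: (eq_lin2 (k := 1) (k' := -1) E Es); rewrite /A9 /B9; ring.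
have Er : A9 (f r) = f s * B9 (f r).
  apply: (eq_lin2 (k := 1) (k' := f r - t) E sE).
  by rewrite fr /A9 /B9; ring.
have r0 : f r != 0.
  apply/eqP => r0; move: Er; rewrite r0 /A9 /B9 expr0n /= mul0r mulr0 => /eqP.
  by rewrite expr0n /= mulr0 subr0 add0r oner_eq0.
have r1 : 1 - f r != 0.
  apply/eqP => /subr0_eq r1; move: Er; rewrite -r1 /A9 /B9 subrr !mulr0 => e.
  by have /eqP := oppr_eq0 (1 : K); rewrite oner_eq0 -[RHS]e; case; ring.
have /eqP : (t - f r) * (t * (1 - f r) - 1) * (t * f r - f r + 1) = 0.
  by apply: (eq_lin2 (k := - B9 (f r)) (k' := B9 t) E Er); rewrite /A9 /B9; ring.
rewrite !mulf_eq0 -orbA => /or3P[] /eqP e.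
- by exists r; apply: subr0_eq.
- exists ((1 - r)^-1); rewrite fmorphV rmorphB rmorph1.
  by apply: (mulIf r1); apply: (eq_lin (k := 1) e); field.
- exists (1 - r^-1); rewrite rmorphB fmorphV rmorph1.
  by apply: (mulIf r0); apply: (eq_lin (k := 1) e); field.
Qed.

End QuadraticField.

(** * Descent of the parameter to the rational numbers *)

(** With [B9h] below, the homogeneous forms of A and B at t = p/q. *)
Definition A9h (p q : int) : int := p ^+ 3 - 3 * p ^+ 2 * q + q ^+ 3.
Definition B9h (p q : int) : int := p * q * (p - q).

(** It is odd, because p and q are not both even. *)
Lemma A9h_neq0 p q : coprimez p q -> A9h p q != 0.
Proof.
move=> cop; apply/eqP; rewrite /A9h => h.
have nev : ~~ ((2 %| p)%Z && (2 %| q)%Z).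
  by rewrite -dvdz_gcd; move: cop; rewrite /coprimez => /eqP ->.
have := divz_eq p 2; have := divz_eq q 2.
have := ltz_pmod p (d := 2) isT; have := modz_ge0 p (d := 2) isT.
have := ltz_pmod q (d := 2) isT; have := modz_ge0 q (d := 2) isT.
move: nev; rewrite !(sameP dvdz_mod0P eqP).
move: (p %/ 2)%Z (p %% 2)%Z (q %/ 2)%Z (q %% 2)%Z => a i b j hn j0 j1 i0 i1 eq ep.
have : [\/ i = 0 /\ j = 1, i = 1 /\ j = 0 | i = 1 /\ j = 1].
  have [i00|i11] : i = 0 \/ i = 1 by lia.
    by constructor 1; subst i; move: hn => /=; lia.
  have [j00|j11] : j = 0 \/ j = 1 by lia.
    by constructor 2.
  by constructor 3.
case=> -[ei ej]; subst i j p q.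
- have : 2 * (4 * a ^+ 3 - 6 * a ^+ 2 * (b * 2 + 1) + 4 * b ^+ 3 + 6 * b ^+ 2 + 3 * b) = - 1 :> int.
    by apply: (eq_lin (k := 1) h); ring.
  by clear; lia.
- have : 2 * (4 * a ^+ 3 + 6 * a ^+ 2 + 3 * a - 3 * (2 * a + 1) ^+ 2 * b + 4 * b ^+ 3) = - 1 :> int.
    by apply: (eq_lin (k := 1) h); ring.
  by clear; lia.
- have : 2 * (4 * a ^+ 3 + 6 * a ^+ 2 + 3 * a - 3 * (2 * a ^+ 2 + 2 * a) * (2 * b + 1)
    - 3 * b + 4 * b ^+ 3 + 6 * b ^+ 2 + 3 * b) = 1 :> int.
    by apply: (eq_lin (k := 1) h); ring.
  by clear; lia.
Qed.

Lemma A9_frac (t : rat) :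
  A9 t * (denq t)%:~R ^+ 3 = (A9h (numq t) (denq t))%:~R.
Proof.
by rewrite /A9h !(rmorphD, rmorphN, rmorphM, rmorphXn) /= numqE /A9; ring.
Qed.

Lemma B9_frac (t : rat) :
  B9 t * (denq t)%:~R ^+ 3 = (B9h (numq t) (denq t))%:~R.
Proof.
by rewrite /B9h !(rmorphD, rmorphN, rmorphM, rmorphXn) /= numqE /B9; ring.
Qed.

Lemma A9_rat_neq0 (t : rat) : A9 t != 0.
Proof.
have : A9 t * (denq t)%:~R ^+ 3 != 0.
  by rewrite A9_frac intr_eq0 A9h_neq0 // coprimezE coprime_num_den.
by apply: contra_neq => ->; rewrite mul0r.
Qed.

Section Descent.
Variable K : fieldType.
Variable f : {rmorphism rat -> K}.
Variable sigma : {rmorphism K -> K}.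
Hypothesis sigma_fixed : forall x, sigma x = x -> exists q : rat, x = f q.
Hypothesis sigmaK : involutive sigma.

Lemma A9_neq0 (t : K) : A9 t != 0.
Proof.
apply/eqP => h.
have [|t0 et] := cyclic_cubic_root sigma_fixed sigmaK (t := t) (s := 0).
  by rewrite h rmorph0 mul0r.
by move/eqP: h; rewrite et -rmorph_A9 fmorph_eq0 (negbTE (A9_rat_neq0 _)).
Qed.

(** The curve y^2 + A x y + B^3 y = x^3 has full 3-torsion over a field
    containing w exactly when A^3 - 27 B^3 is a cube; by Fermat's theorem applied
    to A^3 = (3 B)^3 + h^3, this never happens over K. *)
Lemma fermat_obstruction (w A B h : K) : w ^+ 2 = - 1 - w ->
  A != 0 -> B != 0 -> A ^+ 3 - 27 * B ^+ 3 = h ^+ 3 -> h != 0 -> False.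
Proof.
move=> w2 A0 B0 e h0.
have : A ^+ 3 + (- 3 * B) ^+ 3 + (- h) ^+ 3 = 0 by apply: (eq_lin (k := 1) e); ring.
move/(quadratic_fermat3 sigma_fixed sigmaK w2)/eqP.
rewrite !mulf_eq0 !oppr_eq0 (negbTE A0) (negbTE B0) (negbTE h0) !orbF /=.
by rewrite (negbTE (natK_neq0 f 2)).
Qed.

(** Put rho = sigma(r) - r and suppose that it is not 0.  The conjugate
    flex is a point of order 3 with abscissa r + rho, which makes
    m^3 - 27 n = (m + 3 n / rho)^3 a cube; its second coordinate N satisfies
    3 N^2 = - (m rho + 3 n)^2, so that -3 is a square in K.  Fermat's theorem
    forbids this. *)
Lemma flex_x_rational (W : weierstrass rat) r m v :
  flex_form (map_weierstrass f W) r m (v ^+ 3) ->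
  m != 0 -> v != 0 -> m ^+ 3 - 27 * v ^+ 3 != 0 -> sigma r = r.
Proof.
have b2E : wb2 (map_weierstrass f W) = f (wb2 W).
  by rewrite /wb2 /= !(rmorph_nat, rmorphXn, rmorphM, rmorphD).
have b4E : wb4 (map_weierstrass f W) = f (wb4 W).
  by rewrite /wb4 /= !(rmorph_nat, rmorphXn, rmorphM, rmorphD).
have b6E : wb6 (map_weierstrass f W) = f (wb6 W).
  by rewrite /wb6 /= !(rmorph_nat, rmorphXn, rmorphM, rmorphD).
have fixb q : sigma (f q) = f q by apply: sigma_rat.
rewrite /flex_form b2E b4E b6E; move: (fixb (wb2 W)) (fixb (wb4 W)) (fixb (wb6 W)).
move: (f (wb2 W)) (f (wb4 W)) (f (wb6 W)) => b2 b4 b6 s2 s4 s6 [e2 e4 e6] m0 v0 d0.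
have [//|ne] := eqVneq (sigma r) r; exfalso.
set n := v ^+ 3 in e4 e6 d0.
have shift (x y z : K) : b2 = y ^+ 2 - 12 * x -> b4 = 6 * x ^+ 2 - x * y ^+ 2 + y * z ->
    b6 = (z - y * x) ^+ 2 - 4 * x ^+ 3 ->
    [/\ y ^+ 2 = b2 + 12 * x, y * z = b4 + x * b2 + 6 * x ^+ 2
      & z ^+ 2 = b6 + 2 * x * b4 + x ^+ 2 * b2 + 4 * x ^+ 3].
  by move=> -> -> ->; split; ring.
have [m2 mn n2] := shift _ _ _ e2 e4 e6.
have [m2' mn' n2'] : [/\ sigma m ^+ 2 = b2 + 12 * sigma r,
    sigma m * sigma n = b4 + sigma r * b2 + 6 * sigma r ^+ 2
  & sigma n ^+ 2 = b6 + 2 * sigma r * b4 + sigma r ^+ 2 * b2 + 4 * sigma r ^+ 3].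
  apply: shift.
  - by rewrite -{1}s2 e2 rmorphB rmorphXn rmorphM rmorph_nat.
  - by rewrite -{1}s4 e4 !(rmorph_nat, rmorphXn, rmorphM, rmorphB, rmorphD).
  - by rewrite -{1}s6 e6 !(rmorph_nat, rmorphXn, rmorphM, rmorphB, rmorphD).
have n0 : n != 0 by rewrite expf_neq0.
have n0' : sigma n != 0 by rewrite fmorph_eq0.
clear s2 s4 s6 e2 e4 e6 shift.
pose rho := sigma r - r; have rho0 : rho != 0 by rewrite subr_eq0.
have b2' : b2 = m ^+ 2 - 12 * r by rewrite m2; ring.
have b4' : b4 = m * n - r * m ^+ 2 + 6 * r ^+ 2 by rewrite mn m2; ring.
have b6' : b6 = n ^+ 2 - 2 * r * m * n + r ^+ 2 * m ^+ 2 - 4 * r ^+ 3.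
  by rewrite -mulrA mn n2 m2; ring.
have er : sigma r = r + rho by rewrite addrC subrK.
move: m2' mn' n2'; rewrite {}er {}b2' {}b4' {}b6' => m2' mn' n2'.
clear m2 mn n2.
(* Both r and sigma r are roots of the 3-division polynomial; its Taylor
   expansion at r, evaluated at rho, is 4 rho times the left-hand side. *)
have psi : 3 * rho ^+ 3 + m ^+ 2 * rho ^+ 2 + 3 * m * n * rho + 3 * n ^+ 2 = 0.
  have h : (sigma m * sigma n) ^+ 2 = sigma m ^+ 2 * sigma n ^+ 2 by rewrite exprMn.
  move: h; rewrite mn' m2' n2' => h.
  have k4 : 4 * rho != 0 by rewrite mulf_neq0 // (natK_neq0 f 3).
  by apply: (mulfI k4); apply: (eq_lin (k := -1) h); ring.
have n2E : 3 * sigma n ^+ 2 = - (m * rho + 3 * n) ^+ 2.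
  by rewrite n2'; apply: (eq_lin (k := 4) psi); ring.
have k2 : 2 != 0 :> K := natK_neq0 f 1.
have k3 : 3 != 0 :> K := natK_neq0 f 2.
pose w := (- 1 + (m * rho + 3 * n) / sigma n) / 2.
have w2 : w ^+ 2 = - 1 - w.
  have n2u : sigma n ^+ 2 != 0 by rewrite expf_neq0.
  apply: (mulfI (mulf_neq0 k2 (mulf_neq0 k2 n2u))).
  apply: (eq_lin (k := 1) n2E); rewrite /w; field; by rewrite n0' k2.
have g3 : m ^+ 3 - 27 * v ^+ 3 = (m + 3 * n / rho) ^+ 3.
  apply: (mulIf (expf_neq0 3 rho0)); rewrite -/n.
  by apply: (eq_lin (k := -9 * n) psi); field.
by apply: (fermat_obstruction w2 m0 v0 g3); move: d0; rewrite g3 expf_eq0.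
Qed.

Lemma A9_cube_factor (w t : K) : w ^+ 2 = - 1 - w ->
  (A9 t - 3 * w * B9 t = (t + w ^+ 2) ^+ 3) * (A9 t - 3 * w ^+ 2 * B9 t = (t + w) ^+ 3).
Proof. by move=> w2; split; rewrite /A9 /B9; ring: w2. Qed.

(** Let e = 1 or -1 be the sign by which sigma acts on n; it also acts so on
    m = u A.  For v = u B, v^3 = n shows that z = e sigma(v) / v is a cube root
    of unity, and A/B is z times its conjugate.  If z = 1, then A/B is rational
    and [cyclic_cubic_root] applies.  Otherwise z is primitive and lies in K,
    and comparison of the factorizations of [A9_cube_factor] at t and sigma(t)
    makes A - 3 B a cube, contradicting [fermat_obstruction]. *)
Lemma flex_param_rational (m n : K) (t u : K) :
  m = u * A9 t -> n = (u * B9 t) ^+ 3 -> u != 0 -> B9 t != 0 ->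
  A9 t ^+ 3 - 27 * B9 t ^+ 3 != 0 ->
  sigma (m ^+ 2) = m ^+ 2 -> sigma (m * n) = m * n -> sigma (n ^+ 2) = n ^+ 2 ->
  exists t0, t = f t0 /\ (sigma u = u \/ sigma u = - u).
Proof.
move=> em en u0 B0 d0 sm smn sn.
have A0 := A9_neq0 t.
have v0 : u * B9 t != 0 by rewrite mulf_neq0.
have n0 : n != 0 by rewrite en expf_neq0.
have m0 : m != 0 by rewrite em mulf_neq0.
have [e [he en']] : exists e : K, (e = 1 \/ e = -1) /\ sigma n = e * n.
  move/eqP: sn; rewrite rmorphXn eqf_sqr => /orP[] /eqP ->; [exists 1 | exists (-1)].
    by split; [left | ring].
  by split; [right | ring].
have e2 : e * e = 1 by case: he => ->; ring.
have em' : sigma m = e * m.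
  apply: (mulIf n0); apply: (eq_lin2 (k := e) (k' := - sigma m * n) smn e2).
  by rewrite rmorphM en'; ring.
pose v := u * B9 t; pose z := e * sigma v / v.
have sv : sigma v = e * z * v by rewrite /z; apply: (eq_lin (k := - sigma v) e2); field.
have z3 : z ^+ 3 = 1.
  apply: (mulIf n0); rewrite mul1r {1}en -/v -exprMn.
  have -> : z * v = e * sigma v by rewrite /z; field.
  rewrite exprMn -rmorphXn -/n -en en'.
  by apply: (eq_lin (k := n * (e * e + 1)) e2); ring.
have sAu : sigma u * A9 (sigma t) = e * (u * A9 t).
  by rewrite -rmorph_A9 -rmorphM -em em'.
have sBu : sigma u * B9 (sigma t) = e * z * (u * B9 t).
  by rewrite -rmorph_B9 -rmorphM sv.
have [z1|z1] := eqVneq z 1.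
  have sE : sigma (A9 t / B9 t) = A9 t / B9 t.
    have e0 : e != 0 by case: he => ->; rewrite ?oppr_eq0 oner_neq0.
    have -> : A9 t / B9 t = m / v by rewrite em /v; field; rewrite u0 B0.
    by rewrite fmorph_div em' sv z1; field; rewrite v0 e0.
  have [s es] := sigma_fixed sE.
  have [|t0 et] := cyclic_cubic_root sigma_fixed sigmaK (t := t) (s := s).
    by rewrite -es divfK.
  exists t0; split=> //.
  have su : sigma u = e * u.
    have st : sigma t = t by rewrite et sigma_rat.
    by apply: (mulIf B0); move: sBu; rewrite st z1 => ->; ring.
  by case: he su => -> ->; [left | right]; ring.
exfalso.
have z2 : z ^+ 2 = - 1 - z.
  have z10 : z - 1 != 0 by rewrite subr_eq0.
  by apply: (mulfI z10); apply: (eq_lin (k := 1) z3); ring.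
set t' := sigma t in sAu sBu.
have B0' : B9 t' != 0 by rewrite -rmorph_B9 fmorph_eq0.
have d0' : A9 t' ^+ 3 - 27 * B9 t' ^+ 3 != 0.
  have := d0; rewrite -(fmorph_eq0 sigma) rmorphB rmorphM !rmorphXn rmorph_nat.
  by rewrite rmorph_A9 rmorph_B9.
have prod (s : K) : A9 s ^+ 3 - 27 * B9 s ^+ 3
    = (A9 s - 3 * B9 s) * ((s + z) * (s + z ^+ 2)) ^+ 3.
  by rewrite [in RHS]exprMn -(A9_cube_factor s z2).1 -(A9_cube_factor s z2).2; ring: z2.
have tz0 : t' + z ^+ 2 != 0.
  by apply: contra_neq d0' => tz; rewrite prod tz mulr0 expr0n mulr0.
have u0' : sigma u != 0 by rewrite fmorph_eq0.
have cross : A9 t * B9 t' = z * (A9 t' * B9 t).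
  apply: (mulfI (mulf_neq0 u0 u0')).
  by apply: (eq_lin2 (k := - z * u * B9 t) (k' := u * A9 t) sAu sBu); ring.
pose g := (t' + z) * (t + z) / (t' + z ^+ 2).
have gE : A9 t - 3 * B9 t = g ^+ 3.
  have h1 : B9 t' * (A9 t - 3 * B9 t) = z * (t' + z) ^+ 3 * B9 t.
    rewrite -(A9_cube_factor t' z2).2.
    by apply: (eq_lin (k := 1) cross); ring: z2.
  have h2 : B9 t' * (t + z) ^+ 3 = z * (t' + z ^+ 2) ^+ 3 * B9 t.
    rewrite -(A9_cube_factor t' z2).1 -(A9_cube_factor t z2).2.
    by apply: (eq_lin (k := 1) cross); ring: z2.
  apply: (mulfI (mulf_neq0 B0' (expf_neq0 3 tz0))).
  rewrite /g.
  apply: (eq_lin2 (k := (t' + z ^+ 2) ^+ 3) (k' := - (t' + z) ^+ 3) h1 h2).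
  by field.
pose h := g * ((t + z) * (t + z ^+ 2)).
have hE : A9 t ^+ 3 - 27 * B9 t ^+ 3 = h ^+ 3 by rewrite prod gE /h [in RHS]exprMn.
apply: (fermat_obstruction z2 A0 B0 hE).
by apply: contra_neq d0 => h0; rewrite hE h0 expr0n.
Qed.
End Descent.

(** * The valuation at 3 and equations of type IV *)

Section Valuation.
Variable p : nat.
Hypothesis p_prime : prime p.

Lemma dvdpM (m n : int) : (p %| m * n)%Z = (p %| m)%Z || (p %| n)%Z.
Proof. by rewrite !dvdzE abszM Euclid_dvdM. Qed.

Lemma vp_frac (n m : int) : n != 0 -> m != 0 ->
  vp p (n%:~R / m%:~R) = (logn p `|n|%N)%:Z - (logn p `|m|%N)%:Z.
Proof.
move=> n0 m0; rewrite /vp; set x : rat := _ / _.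
have x0 : x != 0 by rewrite mulf_neq0 ?invr_eq0 ?intr_eq0.
have e : numq x * m = n * denq x.
  apply/eqP; rewrite -(eqr_int rat) !rmorphM /= numqE /x; apply/eqP; field.
  by rewrite intr_eq0.
have := congr1 (fun z : int => logn p `|z|%N) e; rewrite !abszM !lognM ?absz_gt0 ?numq_eq0 ?denq_eq0 //.
by lia.
Qed.

Lemma vp_int (n : int) : n != 0 -> vp p n%:~R = (logn p `|n|%N)%:Z.
Proof. by move=> n0; rewrite -[_%:~R]divr1 (@vp_frac n 1) // logn1 subr0. Qed.

Lemma vp1 : vp p 1 = 0.
Proof. by rewrite (_ : 1 = 1%:~R) // vp_int // logn1. Qed.

Lemma vpM x y : x != 0 -> y != 0 -> vp p (x * y) = vp p x + vp p y.
Proof.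
move=> x0 y0; have [nx ny] : numq x != 0 /\ numq y != 0 by rewrite !numq_eq0.
rewrite -{1}(divq_num_den x) -{1}(divq_num_den y) mulrACA -invfM -!intrM.
rewrite vp_frac ?mulf_neq0 ?denq_eq0 // !abszM !lognM ?absz_gt0 ?denq_eq0 //.
by rewrite /vp; lia.
Qed.

Lemma vpX x n : x != 0 -> vp p (x ^+ n) = n%:Z * vp p x.
Proof.
move=> x0; elim: n => [|n IH]; first by rewrite expr0 vp1 mul0r.
by rewrite exprS vpM ?expf_neq0 // IH; lia.
Qed.

Lemma vpV x : x != 0 -> vp p x^-1 = - vp p x.
Proof.
move=> x0; apply: (addIr (vp p x)); rewrite -vpM ?invr_eq0 // mulVf // addNr. exact: vp1.
Qed.

Lemma vp_p : vp p p%:R = 1.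
Proof. by rewrite (@vp_int p) ?absz_nat ?logn_prime ?eqxx //; case: p p_prime. Qed.

(** A predicate of its own, so that it can carry a subring structure. *)
Definition zloc : {pred rat} := [pred x | vp_ge p 0 x].

Lemma zlocE x : (x \in zloc) = ~~ (p %| denq x)%Z.
Proof.
rewrite inE /vp_ge; have [->|x0] := eqVneq x 0.
  by rewrite /= dvdzE absz1 Euclid_dvd1.
rewrite /= /vp dvdzE /=.
have := coprime_num_den x; have d0 : (0 < `|denq x|)%N by rewrite absz_gt0 denq_eq0.
have n0 : (0 < `|numq x|)%N by rewrite absz_gt0 numq_eq0.
have [dv|ndv] := boolP (p %| `|denq x|)%N => cop /=; last first.
  by rewrite (lognE p `|denq x|) (negbTE ndv) !andbF subr0.
have nn : ~~ (p %| `|numq x|)%N.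
  apply/negP => dn; have := dvdn_gcd p `|numq x| `|denq x|.
  by rewrite dv dn (eqP cop) Euclid_dvd1.
rewrite (lognE p `|numq x|) (negbTE nn) !andbF; apply/negbTE; rewrite -ltNge.
by rewrite sub0r oppr_lt0 ltz_nat logn_gt0 mem_primes p_prime d0.
Qed.

Lemma zlocP x :
  reflect (exists n m : int, ~~ (p %| m)%Z /\ x = n%:~R / m%:~R) (x \in zloc).
Proof.
rewrite zlocE; apply: (iffP idP) => [h|[n [m [hm ->]]]].
  by exists (numq x), (denq x); rewrite divq_num_den.
have m0 : m != 0 by apply: contraNneq hm => ->; rewrite dvdz0.
apply: contraNN hm => h; apply: dvdz_trans h _.
set y := _ / _; have e : numq y * m = n * denq y.
  apply/eqP; rewrite -(eqr_int rat) !rmorphM /= numqE /y; apply/eqP; field.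
  by rewrite intr_eq0.
have : (denq y %| numq y * m)%Z by rewrite e dvdz_mull.
by rewrite Gauss_dvdzr // coprimezE coprime_sym coprime_num_den.
Qed.

Fact zloc_subring : subring_closed zloc.
Proof.
split=> [|x y /zlocP[n [m [hm ->]]] /zlocP[n' [m' [hm' ->]]]|
  x y /zlocP[n [m [hm ->]]] /zlocP[n' [m' [hm' ->]]]].
- by apply/zlocP; exists 1, 1; split; rewrite ?divr1 // dvdzE Euclid_dvd1.
- apply/zlocP; exists (n * m' - n' * m), (m * m').
  rewrite dvdpM negb_or hm hm'; split=> //.
  have m0 : m != 0 by apply: contraNneq hm => ->; rewrite dvdz0.
  have m0' : m' != 0 by apply: contraNneq hm' => ->; rewrite dvdz0.
  by rewrite rmorphB !rmorphM /=; field; rewrite ?intr_eq0 ?m0 ?m0'.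
- apply/zlocP; exists (n * n'), (m * m').
  rewrite dvdpM negb_or hm hm'; split=> //.
  by rewrite !rmorphM /= invfM mulrACA.
Qed.
Lemma p_neq0 : p%:R != 0 :> rat.
Proof. by rewrite pnatr_eq0; case: p p_prime. Qed.

Lemma vp_geE k x : vp_ge p k x = (x / p%:R ^+ k \in zloc).
Proof.
rewrite inE /vp_ge mulf_eq0 invr_eq0 expf_eq0 (negbTE p_neq0) andbF orbF.
have [->//|x0] /= := eqVneq x 0.
rewrite vpM ?invr_eq0 ?expf_neq0 ?p_neq0 // vpV ?expf_neq0 ?p_neq0 //.
by rewrite vpX ?p_neq0 // vp_p mulr1 subr_ge0.
Qed.

Lemma vp_ge_vp k x : x != 0 -> vp_ge p k x = (k%:Z <= vp p x).
Proof. by rewrite /vp_ge => /negbTE ->. Qed.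

Lemma vp_ge_int k (n : int) : vp_ge p k n%:~R = ((p ^ k)%:Z %| n)%Z.
Proof.
have [->|n0] := eqVneq n 0; first by rewrite /vp_ge eqxx dvdz0.
rewrite vp_ge_vp ?intr_eq0 // vp_int // lez_nat dvdzE /=.
by rewrite pfactor_dvdn // absz_gt0.
Qed.

Lemma vp_unit k x : x \in zloc -> ~~ vp_ge p 1 x -> vp p (p%:R ^+ k * x) = k%:Z.
Proof.
move=> hx nx; have x0 : x != 0 by apply: contraNneq nx => ->; rewrite /vp_ge eqxx.
rewrite vpM ?expf_neq0 ?p_neq0 // vpX ?p_neq0 // vp_p mulr1.
move: hx nx; rewrite inE !vp_ge_vp // => h1 h2.
by have -> : vp p x = 0; lia.
Qed.

Lemma vp_geM x y : x \in zloc -> y \in zloc ->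
  vp_ge p 1 (x * y) = vp_ge p 1 x || vp_ge p 1 y.
Proof.
have [->|x0] := eqVneq x 0; first by rewrite mul0r /vp_ge eqxx.
have [->|y0] := eqVneq y 0; first by rewrite mulr0 /vp_ge eqxx orbT.
rewrite !inE !vp_ge_vp ?mulf_neq0 // vpM //; lia.
Qed.

End Valuation.

Notation Z3 := (zloc 3).
HB.instance Definition _ :=
  GRing.isSubringClosed.Build rat Z3 (zloc_subring (isT : prime 3)).

Ltac in_Z3 := repeat lazymatch goal with
  | H : is_true (?x \in _) |- is_true (?x \in _) => exact: H
  | |- is_true ((_ + _) \in _) => apply: rpredD
  | |- is_true (- _ \in _) => rewrite rpredN
  | |- is_true (_ * _ \in _) => apply: rpredM
  | |- is_true (_ ^+ _ \in _) => apply: rpredX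
  | |- is_true (_%:R \in _) => exact: rpred_nat
  end.

Lemma vp_geE3 k x : vp_ge 3 k x = (x / 3 ^+ k \in Z3).
Proof. exact: vp_geE. Qed.

Lemma vp_unit3 k x : x \in Z3 -> ~~ vp_ge 3 1 x -> vp 3 (3 ^+ k * x) = k%:Z.
Proof. exact: vp_unit. Qed.

Lemma vp_geM3 x y : x \in Z3 -> y \in Z3 ->
  vp_ge 3 1 (x * y) = vp_ge 3 1 x || vp_ge 3 1 y.
Proof. exact: vp_geM. Qed.

Lemma vp_geN x : vp_ge 3 1 (- x) = vp_ge 3 1 x.
Proof. by rewrite !vp_geE3 mulNr rpredN. Qed.

Lemma vp_geD k x y : vp_ge 3 k y -> vp_ge 3 k (x + y) = vp_ge 3 k x.
Proof. by rewrite !vp_geE3 mulrDl => hy; rewrite rpredDr. Qed.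

Lemma vp_ge_mul3 y : y \in Z3 -> vp_ge 3 1 (3 * y).
Proof. by move=> hy; rewrite vp_geE3 expr1 mulrAC mulfV // mul1r. Qed.

Lemma vp_geX n x : x \in Z3 -> vp_ge 3 1 (x ^+ n.+1) = vp_ge 3 1 x.
Proof.
move=> hx; elim: n => [|n IH]; first by rewrite expr1.
by rewrite exprS vp_geM ?IH ?orbb //; in_Z3.
Qed.

(** The covariant usually denoted c4. *)
Definition wc4 (F : fieldType) (W : weierstrass F) : F := wb2 W ^+ 2 - 24 * wb4 W.

(** Put b2 = 3 x, b4 = 3 b4', b6 = 9 z with z a unit.  The identity
    4 b8 = b2 b6 - b4^2 and the condition on b8 force 3 to divide b4', so that
    b4 = 9 y.  Substituting, the discriminant is, up to the unit 1/4, 3^5 times an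
    expression congruent to -x^3 z modulo 3.  If 3 divides x, it is 3^6 times an
    expression congruent to -32 y^3, and if 3 also divides y, it is 3^7 times a
    unit.  The bound on c4 = 9 (x^2 - 24 y) follows case by case. *)
Lemma tate_KIV_valuations (W : weierstrass rat) : tate_exit 3 KIV W ->
  (5 <= vp 3 (wdisc W) <= 7) /\ (wc4 W = 0 \/ vp 3 (wdisc W) < 3 * vp 3 (wc4 W)).
Proof.
rewrite /tate_exit /coef_val_ge !vp_geE3 !expr0 !expr1 !divr1.
case/and4P=> /and5P[h1 h2 h3 h4 h6] hb2 hb8 hb6.
have b4z : wb4 W / 3 \in Z3.
  have -> : wb4 W / 3 = 2 * (wa4 W / 3) + wa1 W * (wa3 W / 3) by rewrite /wb4; field.
  by in_Z3.
have b6z : wb6 W / 9 \in Z3.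
  have -> : wb6 W / 9 = (wa3 W / 3) ^+ 2 + 4 * (wa6 W / 3 ^+ 2) by rewrite /wb6; field.
  by in_Z3.
have b8E : 4 * wb8 W = wb2 W * wb6 W - wb4 W ^+ 2 by rewrite /wb8 /wb2 /wb6 /wb4; ring.
have b4z2 : wb4 W / 9 \in Z3.
  have : vp_ge 3 1 (wb4 W / 3).
    rewrite -(vp_geX 1) // (_ : _ ^+ 2 = 3 * (wb2 W / 3 * (wb6 W / 9) - 4 * (wb8 W / 3 ^+ 3))).
      by apply: vp_ge_mul3; in_Z3.
    by apply: (eq_lin (k := 9^-1) b8E); field.
  by rewrite vp_geE3 expr1 -mulrA -invfM.
set x := wb2 W / 3 in hb2; set y := wb4 W / 9 in b4z2; set z := wb6 W / 9 in b6z.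
have zu : ~~ vp_ge 3 1 z.
  by apply: contra hb6; rewrite vp_geE3 /z expr1 -mulrA -invfM.
have e2 : wb2 W = 3 * x by rewrite /x; field.
have e4 : wb4 W = 9 * y by rewrite /y; field.
have e6 : wb6 W = 9 * z by rewrite /z; field.
have e8 : wb8 W = 27 / 4 * (x * z - 3 * y ^+ 2).
  by apply: (eq_lin (k := 4^-1) b8E); rewrite e2 e4 e6; field.
have q4 : 4^-1 \in Z3 by [].
have eD : wdisc W = 3 ^+ 5 * (4^-1 * (- (x ^+ 3 * z)
    + 3 * (x ^+ 2 * y ^+ 2 - 32 * y ^+ 3 - 12 * z ^+ 2 + 12 * x * y * z))).
  by rewrite /wdisc e8 e2 e4 e6; field.
have eC : wc4 W = 3 ^+ 2 * (x ^+ 2 - 24 * y) by rewrite /wc4 e2 e4; ring.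
have c4le k w : w \in Z3 -> wc4 W = 3 ^+ k * w -> wc4 W = 0 \/ k%:Z <= vp 3 (wc4 W).
  move=> hw ew; have [->|c0] := eqVneq (wc4 W) 0; [by left | right].
  have k0 : (3 ^+ k : rat) != 0 by apply: expf_neq0.
  by rewrite -(vp_ge_vp _ _ c0) vp_geE3 ew mulrAC mulfV // mul1r.
have unit4 (w : rat) : w \in Z3 -> vp_ge 3 1 (4^-1 * w) = vp_ge 3 1 w by move=> hw; rewrite vp_geM3.
clearbody x y z; clear q4.
have [x3|xu] := boolP (vp_ge 3 1 x); last first.
  have -> : vp 3 (wdisc W) = 5.
    rewrite eD vp_unit3 ?unit4; [by [] | by in_Z3 | | by in_Z3].
    rewrite vp_geD; last by apply: vp_ge_mul3; in_Z3.
    rewrite vp_geN vp_geM3; [|by in_Z3..].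
    by rewrite vp_geX // negb_or xu zu.
  split; first by [].
  have [|->|hc] := c4le 2%N (x ^+ 2 - 24 * y) _ eC; [by in_Z3 | by left | right].
  by move: hc; clear; move: (vp 3 _) => v; lia.
move: x3; rewrite vp_geE3 expr1; set g := x / 3 => hg.
have ex : x = 3 * g by rewrite /g; field.
have {c4le}hc : wc4 W = 0 \/ 3%:Z <= vp 3 (wc4 W).
  by apply: (c4le 3%N (3 * g ^+ 2 - 8 * y)); [in_Z3 | rewrite eC ex; ring].
have {}eD : wdisc W = 3 ^+ 6 * (4^-1 * (- 32 * y ^+ 3
    + 3 * (-3 * g ^+ 3 * z + 3 * g ^+ 2 * y ^+ 2 - 4 * z ^+ 2 + 12 * g * y * z))).
  by rewrite eD ex; field.
have [y3|yu] := boolP (vp_ge 3 1 y); last first.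
  have -> : vp 3 (wdisc W) = 6.
    rewrite eD vp_unit3 ?unit4; [by [] | by in_Z3 | | by in_Z3].
    rewrite vp_geD; last by apply: vp_ge_mul3; in_Z3.
    rewrite vp_geM3; [|by in_Z3..].
    by rewrite vp_geX // negb_or yu.
  split; first by [].
  case: hc => [->|hc]; [by left | right].
  by move: hc; clear; move: (vp 3 _) => v; lia.
move: y3; rewrite vp_geE3 expr1; set h := y / 3 => hh.
have ey : y = 3 * h by rewrite /h; field.
have -> : vp 3 (wdisc W) = 7.
  have -> : wdisc W = 3 ^+ 7 * (4^-1 * (- 4 * z ^+ 2
     + 3 * (- 96 * h ^+ 3 - g ^+ 3 * z + 9 * g ^+ 2 * h ^+ 2 + 12 * g * h * z))).
    by rewrite eD ey; field.
  rewrite vp_unit3 ?unit4; [by [] | by in_Z3 | | by in_Z3].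
  rewrite vp_geD; last by apply: vp_ge_mul3; in_Z3.
  rewrite vp_geM3; [|by in_Z3..].
  by rewrite vp_geX // negb_or zu.
split; first by [].
case: hc => [->|hc]; [by left | right].
by move: hc; clear; move: (vp 3 _) => v; lia.
Qed.

(** * Models and the quadratic twist *)

Section Models.
Variable F : fieldType.
Implicit Types E W V : weierstrass F.

Lemma is_model_trans E V W : is_model_of E V -> is_model_of V W -> is_model_of E W.
Proof.
case=> u [r [s [t [u0 ->]]]] [u' [r' [s' [t' [u'0 ->]]]]].
exists (u * u'), (u ^+ 2 * r' + r), (u * s' + s), (u ^+ 3 * t' + u ^+ 2 * s * r' + t).
split; first by rewrite mulf_neq0.
by case: E => a1 a2 a3 a4 a6; rewrite /wchange /=; congr Weierstrass; field; rewrite u0 u'0.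
Qed.

Lemma is_model_invariants E W : is_model_of E W ->
  exists u, [/\ u != 0, wc4 E = u ^+ 4 * wc4 W & wdisc E = u ^+ 12 * wdisc W].
Proof.
case=> u [r [s [t [u0 ->]]]]; exists u; split=> //.
  by case: E => a1 a2 a3 a4 a6; rewrite /wc4 /wb2 /wb4 /=; field.
by case: E => a1 a2 a3 a4 a6; rewrite /wdisc /wb2 /wb4 /wb6 /wb8 /=; field.
Qed.

(** Completing the square gives a model with a1 = a3 = 0 as soon as the
    coefficients b2, b4, b6 have the right values. *)
Lemma is_model_of_b E (u r a2 a4 a6 : F) : u != 0 -> 2 != 0 :> F ->
  wb2 E = 4 * u ^+ 2 * a2 - 12 * r ->
  wb4 E = 2 * u ^+ 4 * a4 - r * wb2 E - 6 * r ^+ 2 ->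
  wb6 E = 4 * u ^+ 6 * a6 - 2 * r * wb4 E - r ^+ 2 * wb2 E - 4 * r ^+ 3 ->
  is_model_of E (Weierstrass 0 a2 0 a4 a6).
Proof.
move=> u0 k2; case: E => b1 b2 b3 b4 b6; rewrite /wb2 /wb4 /wb6 /= => e2 e4 e6.
have k4 : 4 != 0 :> F by rewrite (_ : 4 = 2 * 2) ?mulf_neq0 // -natrM.
exists u, r, (- b1 / 2), (- (b3 + r * b1) / 2); split=> //.
rewrite /wchange /=; congr Weierstrass.
- by field; rewrite ?u0 ?k2 ?k4.
- by apply: (eq_lin (k := - (4 * u ^+ 2)^-1) e2); field; rewrite ?u0 ?k2 ?k4.
- by field; rewrite ?u0 ?k2 ?k4.
- by apply: (eq_lin (k := - (2 * u ^+ 4)^-1) e4); field; rewrite ?u0 ?k2 ?k4.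
- by apply: (eq_lin (k := - (4 * u ^+ 6)^-1) e6); field; rewrite ?u0 ?k2 ?k4.
Qed.
End Models.

(** The quadratic twist by d of y^2 + A x y + B^3 y = x^3, whose completed
    square is Y^2 = 4 x^3 + (A x + B^3)^2; x has been multiplied by 4 d and Y
    accordingly, to make the coefficients integral. *)
Definition twist_form (d A B : int) : weierstrass int :=
  Weierstrass 0 (d * A ^+ 2) 0 (8 * d ^+ 2 * A * B ^+ 3) (16 * d ^+ 3 * B ^+ 6).

Definition twist_model d A B : weierstrass rat := map_weierstrass intr (twist_form d A B).

Lemma twist_wc4 d A B :
  wc4 (twist_model d A B) = (16 * d ^+ 2 * A * (A ^+ 3 - 24 * B ^+ 3))%:~R.
Proof.
rewrite /wc4 /wb2 /wb4 /= !(rmorph_nat, rmorph0, rmorphXn, rmorphM, rmorphB); ring.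
Qed.

Lemma twist_wdisc d A B :
  wdisc (twist_model d A B) = (2 ^+ 12 * d ^+ 6 * B ^+ 9 * (A ^+ 3 - 27 * B ^+ 3))%:~R.
Proof.
rewrite /wdisc /wb2 /wb4 /wb6 /wb8 /=.
rewrite !(rmorph_nat, rmorph0, rmorphXn, rmorphM, rmorphB); ring.
Qed.

Lemma dvd3X (m : int) n : (3 %| m ^+ n.+1)%Z = (3 %| m)%Z.
Proof.
by elim: n => [|n IH]; rewrite ?expr1 // exprS dvd3M IH orbb.
Qed.

Lemma dvd3_cube (x : int) : (3 %| x ^+ 3 - x)%Z.
Proof.
have [k [s [-> hs]]] : exists k s, x = 3 * k + s /\ (s = 0 \/ s = 1 \/ s = -1).
  by exists ((x + 1)%R %/ 3)%Z, (((x + 1)%R %% 3)%Z - 1); split; lia.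
apply/dvdzP; exists (9 * k ^+ 3 + 9 * k ^+ 2 * s + 3 * k * s ^+ 2 - k).
by case: hs => [->|[->|->]]; ring.
Qed.

(** Modulo 3, A is (p + q)^3 and p q (p^2 - q^2) vanishes, so that 3 divides
    exactly one of A and B.  When p = 3 k - q, expanding A and B at k = 0 shows
    that A - 3 B is 9 times an integer b congruent to - q^3 modulo 3. *)
Lemma reduction_cases (p q : int) : coprimez p q ->
  let A := A9h p q in let B := B9h p q in
  (~~ (3 %| A)%Z /\ (3 %| B)%Z) \/
  exists b, [/\ ~~ (3 %| b)%Z, ~~ (3 %| B)%Z & A = 3 * (B + 3 * b)].
Proof.
move=> cop /=; rewrite /A9h /B9h.
have [/dvdzP[k hk]|npq] := boolP (3 %| p + q)%Z; last first.
  left; split.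
    apply: contra npq => h; have : (3 %| (p + q) ^+ 3)%Z.
      rewrite (_ : (p + q) ^+ 3 = p ^+ 3 - 3 * p ^+ 2 * q + q ^+ 3
        + (2 * p ^+ 2 * q + p * q ^+ 2) * 3); last by ring.
      by rewrite rpredD // dvdz_mull.
    by rewrite dvd3X.
  have : (3 %| (p * q * (p - q)) * (p + q))%Z.
    rewrite (_ : _ * _ = q * (p ^+ 3 - p) - p * (q ^+ 3 - q)); last by ring.
    by rewrite rpredB // dvdz_mull // dvd3_cube.
  by rewrite dvd3M (negbTE npq) orbF.
right; have ep : p = 3 * k - q by rewrite [3 * k]mulrC -hk addrK.
have nq : ~~ (3 %| q)%Z.
  apply/negP => hq; have : (3 %| gcdz p q)%Z.
    by rewrite dvdz_gcd hq ep rpredB // dvdz_mulr.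
  by move: cop; rewrite /coprimez => /eqP ->.
exists (- q ^+ 3 + 6 * q ^+ 2 * k - 9 * q * k ^+ 2 + 3 * k ^+ 3); split.
- rewrite (_ : _ + _ = - q ^+ 3 + (2 * q ^+ 2 * k - 3 * q * k ^+ 2 + k ^+ 3) * 3); last by ring.
  rewrite rpredDr; last exact: dvdz_mull.
  by rewrite rpredN dvd3X.
- rewrite ep !dvd3M !negb_or nq andbT.
  apply/andP; split.
    by rewrite rpredBl ?nq //; apply: dvdz_mulr.
  rewrite (_ : _ - _ = (k - q) * 3 + q); last by ring.
  by rewrite rpredDl ?nq //; apply: dvdz_mull.
- by rewrite ep; ring.
Qed.

(** * Reduction at 3 of the twisted curve *)

Lemma models_scale (F : fieldType) (E V W : weierstrass F) :
  is_model_of E V -> is_model_of E W ->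
  exists w, [/\ w != 0, wc4 V = w ^+ 4 * wc4 W & wdisc V = w ^+ 12 * wdisc W].
Proof.
move=> /is_model_invariants[u [u0 e4 eD]] /is_model_invariants[v [v0 f4 fD]].
exists (v / u); split; first by rewrite mulf_neq0 ?invr_eq0.
  apply: (mulfI (expf_neq0 4 u0)); rewrite -e4 f4; field; exact: u0.
apply: (mulfI (expf_neq0 12 u0)); rewrite -eD fD; field; exact: u0.
Qed.

Lemma p_integral_wc4 W : p_integral 3 W -> wc4 W \in Z3.
Proof.
rewrite /p_integral !vp_geE3 expr0 !divr1 => /and5P[h1 h2 h3 h4 h6].
by rewrite /wc4 /wb2 /wb4; in_Z3.
Qed.

Lemma p_integral_wdisc W : p_integral 3 W -> wdisc W \in Z3.
Proof.
rewrite /p_integral !vp_geE3 expr0 !divr1 => /and5P[h1 h2 h3 h4 h6].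
by rewrite /wdisc /wb2 /wb4 /wb6 /wb8; in_Z3.
Qed.

Lemma vp_ge0 x : x != 0 -> x \in Z3 -> 0 <= vp 3 x.
Proof. by move=> x0; rewrite inE vp_ge_vp. Qed.

Lemma vp3M x y : x != 0 -> y != 0 -> vp 3 (x * y) = vp 3 x + vp 3 y.
Proof. exact: vpM. Qed.

Lemma vp3X x n : x != 0 -> vp 3 (x ^+ n) = n%:Z * vp 3 x.
Proof. exact: vpX. Qed.

Lemma models_vp (E V W : weierstrass rat) :
  is_model_of E V -> is_model_of E W -> wdisc V != 0 ->
  exists v : int, [/\ wdisc W != 0,
      vp 3 (wdisc V) = 12 * v + vp 3 (wdisc W)
    & wc4 V != 0 -> wc4 W != 0 /\ vp 3 (wc4 V) = 4 * v + vp 3 (wc4 W)].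
Proof.
move=> hV hW V0; have [w [w0 e4 eD]] := models_scale hV hW.
have W0 : wdisc W != 0 by apply: contraNneq V0 => W0; rewrite eD W0 mulr0.
exists (vp 3 w); split=> //; first by rewrite eD vp3M ?expf_neq0 // vp3X.
move=> c0; have W40 : wc4 W != 0 by apply: contraNneq c0 => W40; rewrite e4 W40 mulr0.
by split=> //; rewrite e4 vp3M ?expf_neq0 // vp3X.
Qed.

(** A change of variables with factor u divides the discriminant by u^12 and
    c4 by u^4: when one of them has valuation below 12, resp. 4, no integral model
    has a smaller discriminant. *)
Lemma minimal_criterion E V : is_elliptic E -> is_model_of E V -> p_integral 3 V ->
  vp 3 (wdisc V) < 12 \/ wc4 V != 0 /\ vp 3 (wc4 V) < 4 ->
  minimal_model 3 E V.
Proof.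
move=> hE hV iV cond; split=> // W hW iW.
have V0 : wdisc V != 0.
  have [u [u0 _ e]] := is_model_invariants hV.
  by apply: contraNneq hE => V0; rewrite e V0 mulr0.
have [v [W0 vD v4]] := models_vp hV hW V0.
suff : v <= 0 by move: vD; clear; move: (vp 3 _) (vp 3 _) => a b; lia.
rewrite leNgt; apply/negP => v1.
have gD := vp_ge0 W0 (p_integral_wdisc iW).
case: cond => [|[c0]].
  by move: vD gD v1; clear; move: (vp 3 _) (vp 3 _) => a b; lia.
have [W40 {}v4] := v4 c0; have g4 := vp_ge0 W40 (p_integral_wc4 iW).
by move: v4 g4 v1; clear; move: (vp 3 _) (vp 3 _) => a b; lia.
Qed.

Lemma F3_int_eq0 (n : int) : (n%:~R == 0 :> 'F_3) = (3 %| n)%Z.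
Proof. by rewrite (dvdz_pcharf (pchar_Fp (isT : prime 3))). Qed.

Lemma ratr_F3_int (n : int) : ratr n%:~R = n%:~R :> 'F_3.
Proof. by rewrite ratr_int. Qed.

Lemma clear_denominators (F : fieldType) (n m n' m' : F) : m != 0 -> m' != 0 ->
  (n / m) ^+ 2 + 4 * (n' / m') = 0 -> n ^+ 2 * m' + 4 * n' * m ^+ 2 = 0.
Proof.
by move=> m0 m0' e; apply: (eq_lin (k := m ^+ 2 * m') e); field; rewrite m0 m0'.
Qed.

(** The tangents at the singular point coincide when a1^2 + 4 (3 x + a2)
    vanishes; in characteristic 3 this is the reduction of b2. *)
Lemma cusp_wb2 W : p_integral 3 W ->
  has_cusp (map_weierstrass (ratr : rat -> 'F_3) W) -> vp_ge 3 1 (wb2 W).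
Proof.
move=> /and5P[h1 h2 _ _ _] [x [y [_ _ _]]] /=.
have k3 : 3 = 0 :> 'F_3 by apply/val_inj.
have d1 : ~~ (3 %| denq (wa1 W))%Z by rewrite -zlocE //; exact: h1.
have d2 : ~~ (3 %| denq (wa2 W))%Z by rewrite -zlocE //; exact: h2.
rewrite k3 mul0r add0r => /clear_denominators; rewrite !F3_int_eq0 => /(_ d1 d2) e.
have {e} : (3 %| numq (wa1 W) ^+ 2 * denq (wa2 W) + 4 * numq (wa2 W) * denq (wa1 W) ^+ 2)%Z.
  rewrite -F3_int_eq0 rmorphD (rmorphM _ (numq _ ^+ 2)) (rmorphM _ (4 * _)) (rmorphM _ 4).
  by rewrite !rmorphXn e.
case/dvdzP => k ek; rewrite vp_geE3 zlocE //; rewrite -zlocE //.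
apply/zlocP => //; exists k, (denq (wa1 W) ^+ 2 * denq (wa2 W)); split.
  by rewrite !(dvd3X, dvd3M) ?negb_or d1 d2.
have e : (numq (wa1 W))%:~R ^+ 2 * (denq (wa2 W))%:~R
   + 4 * (numq (wa2 W))%:~R * (denq (wa1 W))%:~R ^+ 2 = k%:~R * 3 :> rat.
  by rewrite -[3]/(3%:~R) -rmorphM -ek !(rmorphXn, rmorphM, rmorphD).
have -> : (denq (wa1 W) ^+ 2 * denq (wa2 W))%:~R
  = (denq (wa1 W))%:~R ^+ 2 * (denq (wa2 W))%:~R :> rat by rewrite rmorphM rmorphXn.
rewrite expr1 /wb2.
rewrite -[in LHS](divq_num_den (wa1 W)) -[in LHS](divq_num_den (wa2 W)).
have n1 : (denq (wa1 W))%:~R != 0 :> rat by rewrite intr_eq0.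
have n2 : (denq (wa2 W))%:~R != 0 :> rat by rewrite intr_eq0.
move: e n1 n2; move: (numq (wa1 W))%:~R (denq (wa1 W))%:~R (numq (wa2 W))%:~R (denq (wa2 W))%:~R k%:~R.
move=> a b a' b' c.
move=> e n1 n2; apply: (eq_lin (k := (3 * b ^+ 2 * b')^-1) e); field.
by rewrite n1 n2.
Qed.

Lemma vp3_int k (u : int) : ~~ (3 %| u)%Z -> vp 3 (3 ^+ k * u%:~R) = k%:Z.
Proof. by move=> hu; rewrite vp_unit3 ?rpred_int // vp_ge_int. Qed.

Lemma short_form_b (a2 a4 a6 : int) :
  let W : weierstrass rat := map_weierstrass intr (Weierstrass 0 a2 0 a4 a6) in
  [/\ wb2 W = (4 * a2)%:~R, wb6 W = (4 * a6)%:~R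
    & wb8 W = (4 * a2 * a6 - a4 ^+ 2)%:~R].
Proof.
by rewrite /wb2 /wb6 /wb8 /=; split;
  rewrite !(rmorph_nat, rmorph0, rmorphXn, rmorphM, rmorphB); ring.
Qed.

Section TwistReduction.
Variables (E : weierstrass rat) (d A B b : int).
Hypothesis hE : is_elliptic E.
Hypothesis hd : square_free d.
Let V := twist_model d A B.
Hypothesis hV : is_model_of E V.

Lemma twist_integral : p_integral 3 V.
Proof.
have int0 (n : int) : vp_ge 3 0 n%:~R by rewrite vp_geE3 expr0 divr1 rpred_int.
by rewrite /p_integral !int0.
Qed.

Lemma square_free3 : (3 %| d)%Z -> exists2 d', d = 3 * d' & ~~ (3 %| d')%Z.
Proof.
case/dvdzP => d' ed; exists d'; first by rewrite mulrC.
apply/negP => /dvdzP[e ee]; have := hd (m := 3); rewrite ed ee.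
rewrite (_ : e * 3 * 3 = e * 3 ^+ 2); last by ring.
by rewrite dvdz_mull // => /(_ isT).
Qed.

Lemma twist_cusp : (3 %| d)%Z -> has_cusp (map_weierstrass (ratr : rat -> 'F_3) V).
Proof.
move=> /dvdzP[e ed]; have z (n : int) : (3 %| n)%Z -> ratr n%:~R = 0 :> 'F_3.
  by rewrite -F3_int_eq0 ratr_F3_int => /eqP.
have z4 : (3 %| 8 * d ^+ 2 * A * B ^+ 3)%Z.
  by rewrite ed (_ : _ * _ = 24 * e ^+ 2 * A * B ^+ 3 * 3) ?dvdz_mull //; ring.
have z6 : (3 %| 16 * d ^+ 3 * B ^+ 6)%Z.
  by rewrite ed (_ : _ * _ = 144 * e ^+ 3 * B ^+ 6 * 3) ?dvdz_mull //; ring.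
have z2 : (3 %| d * A ^+ 2)%Z by rewrite ed mulrAC dvdz_mull.
exists 0, 0; rewrite /on_curve /= !z ?dvdz0 //.
by split; ring.
Qed.

Hypothesis hA : A ^+ 3 - 27 * B ^+ 3 != 0.
Hypothesis hB : B != 0.

Lemma square_free_neq0 : d != 0.
Proof.
by apply/eqP => d0; have := hd (m := 0); rewrite d0 dvdz0 normr0 => /(_ isT).
Qed.

(** Here c4 = 16 d^2 A (A^3 - 24 B^3) has valuation twice that of d, and the
    discriminant is divisible by d^6 B^9.  If 3 divides d, then c4 has valuation 2,
    so the twisted equation is minimal, and 3 v(c4) = 6 < v(Delta) excludes
    type IV.  If 3 does not divide d, then c4 is a unit, whereas an additive
    minimal model would have c4 divisible by 3, which is possible only with a
    larger discriminant. *)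
Lemma twist_cuspidal_case : ~~ (3 %| A)%Z -> (3 %| B)%Z ->
  (3 %| d)%Z <-> (additive_reduction 3 E /\ ~ has_kodaira_symbol 3 E KIV).
Proof.
move=> nA dB; have d0 := square_free_neq0.
have /dvdzP[B' eB] := dB.
have nu : ~~ (3 %| 16 * A * (A ^+ 3 - 24 * B ^+ 3))%Z.
  rewrite !dvd3M !negb_or nA /=.
  rewrite (_ : _ - _ = A ^+ 3 - (8 * B ^+ 3) * 3); last by ring.
  rewrite rpredBr; last exact: dvdz_mull.
  by rewrite !(dvd3X, dvd3M) ?negb_or nA.
have c4E : wc4 V = (d ^+ 2)%:~R * (16 * A * (A ^+ 3 - 24 * B ^+ 3))%:~R.
  by rewrite twist_wc4 -rmorphM; congr (_%:~R); ring.
have dE : wdisc V != 0.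
  by rewrite twist_wdisc intr_eq0 !mulf_neq0 ?expf_neq0.
split=> [d3|[[W [mW cW]] _]].
  have [d' ed nd'] := square_free3 d3.
  have vc : vp 3 (wc4 V) = 2.
    rewrite c4E (_ : _ * _ = 3 ^+ 2 * (d' ^+ 2 * (16 * A * (A ^+ 3 - 24 * B ^+ 3)))%:~R).
      rewrite vp3_int // dvd3M negb_or nu andbT.
      by rewrite !(dvd3X, dvd3M) ?negb_or nd'.
    by rewrite ed !(rmorph_nat, rmorphXn, rmorphM, rmorphB); ring.
  have c40 : wc4 V != 0.
    by apply/eqP => c0; move: vc; rewrite c0.
  have vD : 7 <= vp 3 (wdisc V).
    rewrite -(vp_ge_vp 3 7) // twist_wdisc vp_ge_int // ed eB; apply/dvdzP.
    by exists (2 ^+ 12 * 3 ^+ 8 * d' ^+ 6 * B' ^+ 9 * (A ^+ 3 - 27 * (B' * 3) ^+ 3)); ring.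
  split; first exists V.
    split; last exact: twist_cusp.
    apply: minimal_criterion => //; first exact: twist_integral.
    by right; split; rewrite ?vc.
  case=> W [mW /tate_KIV_valuations[_ hW]].
  have [v [WD0 eD e4]] := models_vp hV mW dE; have [W40 {}e4] := e4 c40.
  case: hW => [/eqP|hW]; first by rewrite (negbTE W40).
  by move: vc vD hW; rewrite e4 eD; clear; move: (vp 3 _) (vp 3 _) => x y; lia.
have [//|nd] := boolP (3 %| d)%Z; exfalso.
have vc : vp 3 (wc4 V) = 0.
  have h : ~~ (3 %| d ^+ 2 * (16 * A * (A ^+ 3 - 24 * B ^+ 3)))%Z.
    by rewrite dvd3M negb_or nu andbT dvd3X nd.
  by have := vp3_int 0 h; rewrite expr0 mul1r c4E -rmorphM.
have [mE iW minW] := mW.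
have c40 : wc4 V != 0.
  rewrite c4E mulf_neq0 ?intr_eq0 ?expf_neq0 //.
  by apply: contraNneq nu => ->; rewrite dvdz0.
have [v [WD0 eD e4]] := models_vp hV mE dE; have [W40 {}e4] := e4 c40.
have gW : vp_ge 3 1 (wc4 W).
  have [b2z b4z] : wb2 W \in Z3 /\ wb4 W \in Z3.
    have := iW; rewrite /p_integral !vp_geE3 expr0 !divr1 => /and5P[h1 h2 h3 h4 h6].
    by rewrite /wb2 /wb4; split; in_Z3.
  have -> : wc4 W = wb2 W ^+ 2 + 3 * (- 8 * wb4 W) by rewrite /wc4; ring.
  rewrite vp_geD; last by apply: vp_ge_mul3; in_Z3.
  by rewrite (vp_geX 1 b2z); exact: cusp_wb2.
have minV := minW V hV twist_integral.
move: gW vc minV; rewrite vp_ge_vp // e4 eD; clear.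
by move: (vp 3 _) (vp 3 _) => x y; lia.
Qed.

(** Writing A = 3 (B + 3 b), one gets
    A^3 - 27 B^3 = 3^5 b (B^2 + 3 B b + 3 b^2), so that the discriminant has
    valuation 5 + 6 v(d).  If 3 divides d, the value 11 shows that the equation is
    minimal, and every model has a discriminant of valuation 11 modulo 12, which
    excludes type IV.  If 3 does not divide d, a translate of the equation
    satisfies the exit conditions for type IV. *)
Lemma twist_wild_case : ~~ (3 %| b)%Z -> ~~ (3 %| B)%Z -> A = 3 * (B + 3 * b) ->
  (3 %| d)%Z <-> (additive_reduction 3 E /\ ~ has_kodaira_symbol 3 E KIV).
Proof.
move=> nb nB eA; have d0 := square_free_neq0.
have dE : wdisc V != 0.
  by rewrite twist_wdisc intr_eq0 !mulf_neq0 ?expf_neq0.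
split=> [d3|[_ nIV]].
  have [d' ed nd'] := square_free3 d3.
  have vD : vp 3 (wdisc V) = 11.
    rewrite twist_wdisc.
    have -> : (2 ^+ 12 * d ^+ 6 * B ^+ 9 * (A ^+ 3 - 27 * B ^+ 3))%:~R
      = 3 ^+ 11 * (2 ^+ 12 * d' ^+ 6 * B ^+ 9 * b * (B ^+ 2 + (B * b + b ^+ 2) * 3))%:~R :> rat.
      by rewrite ed eA !(rmorph_nat, rmorphXn, rmorphM, rmorphB, rmorphD); ring.
    rewrite vp3_int //.
    rewrite !(dvd3X, dvd3M) ?negb_or nd' nB nb /= .
    rewrite rpredDr; last exact: dvdz_mull.
    by rewrite !(dvd3X, dvd3M) ?negb_or nB.
  split; first exists V.
    split; last exact: twist_cusp.
    apply: minimal_criterion => //; first exact: twist_integral.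
    by left; rewrite vD.
  case=> W [mW /tate_KIV_valuations[hW _]].
  have [v [_ eD _]] := models_vp hV mW dE.
  by move: vD hW; rewrite eD; clear; move: (vp 3 _) => x; lia.
have [//|nd] := boolP (3 %| d)%Z; exfalso; apply: nIV.
(* Modulo 3 the cubic is (x + d B^2)^3, so that x = - d B^2 must be moved to 0.
   The representative - 4 d B^2 makes the new a6 factor as
   16 d^3 B^4 (A + B) (A - 3 B). *)
pose a2 := 3 * (d * (3 * (B + 3 * b) ^+ 2 - 4 * B ^+ 2)).
pose a4 := 9 * (- 8 * d ^+ 2 * B ^+ 2 * b * (5 * B + 9 * b)).
pose a6 := 9 * (16 * d ^+ 3 * B ^+ 4 * b * (4 * B + 9 * b)).
exists (map_weierstrass intr (Weierstrass 0 a2 0 a4 a6)); split.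
  apply: is_model_trans hV _.
  exists 1, (- 4 * d * B ^+ 2)%:~R, 0, 0; split; first exact: oner_neq0.
  rewrite /V /twist_model /wchange /=; congr Weierstrass; rewrite ?expr1n ?divr1.
  - rewrite /= /a2 eA !(rmorph_nat, rmorph0, rmorphXn, rmorphM, rmorphN, rmorphB, rmorphD).
    by ring.
  - by rewrite /= !mulr0 !addr0.
  - rewrite /= /a4 eA !(rmorph_nat, rmorph0, rmorphXn, rmorphM, rmorphN, rmorphB, rmorphD).
    by ring.
  - rewrite /= /a6 eA !(rmorph_nat, rmorph0, rmorphXn, rmorphM, rmorphN, rmorphB, rmorphD).
    by ring.
set W := map_weierstrass _ _.
have [e2 e6 e8] := short_form_b a2 a4 a6.
rewrite /tate_exit /coef_val_ge e2 e6 e8 /= !(vp_ge_int (isT : prime 3)).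
clear e2 e6 e8; clearbody W; apply/and4P; split.
- apply/and3P; split; first exact: dvd1z; last exact: dvdz_mulr.
  by rewrite /a4 (_ : 9 = 3 * 3) // -mulrA dvdz_mulr.
- by rewrite /a2 mulrCA dvdz_mulr.
- apply/dvdzP; exists (4 * (d * (3 * (B + 3 * b) ^+ 2 - 4 * B ^+ 2))
    * (16 * d ^+ 3 * B ^+ 4 * b * (4 * B + 9 * b))
    - 3 * (8 * d ^+ 2 * B ^+ 2 * b * (5 * B + 9 * b)) ^+ 2).
  by rewrite /a2 /a4 /a6 (_ : Posz (3 ^ 3) = 27) //; ring.
have -> : 4 * a6 = 9 * (64 * d ^+ 3 * B ^+ 4 * b * (4 * B + 9 * b)).
  by rewrite /a6; ring.
rewrite (_ : ((3 ^ 3)%N : int) = 9 * 3) // dvdz_mul2l //=.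
rewrite !(dvd3X, dvd3M) ?negb_or nd nB nb /=.
rewrite rpredDr; last by apply: dvdz_mulr.
by rewrite !(dvd3X, dvd3M) ?negb_or nB.
Qed.
End TwistReduction.

(** * Conjugation and discriminant of a quadratic field *)

Section QuadraticExtension.
Variable K : fieldExtType rat.
Hypothesis hK : \dim {:K} = 2%N.
Variables (d : int) (s : K).
Hypothesis hs : s ^+ 2 = d%:~R.
Hypothesis hgen : <<1%VS; s>>%VS = {:K}%VS.

Lemma sqrt_irrational (q : rat) : s != q%:A.
Proof.
apply/eqP => es; have : s \in 1%VS by rewrite es rpredZ // mem1v.
move/Fadjoin_idP; rewrite hgen => e1.
by have := hK; rewrite e1 dimv1.
Qed.

(** Otherwise s would be a quotient of rational numbers. *)
Lemma sqrt_coord_uniq (a b a' b' : rat) :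
  a%:A + b *: s = a'%:A + b' *: s -> a = a' /\ b = b'.
Proof.
move=> e; have e' : (b - b') *: s = (a' - a)%:A.
  by rewrite !scalerBl; apply: (eq_lin (k := 1) e); rewrite mul1r; ring.
have [bb|bb] := eqVneq b b'.
  split=> //; move: e'; rewrite bb subrr scale0r => /esym/eqP.
  by rewrite scaler_eq0 oner_eq0 orbF subr_eq0 => /eqP.
have bn : b - b' != 0 by rewrite subr_eq0.
case/eqP: (sqrt_irrational ((b - b')^-1 * (a' - a))).
by rewrite -scalerA -e' scalerA mulVf // scale1r.
Qed.

Lemma sqrt_coord (x : K) : exists a b : rat, x = a%:A + b *: s.
Proof.
have fr : free [:: s; 1].
  rewrite free_cons seq1_free oner_neq0 andbT span_seq1.
  apply/negP => /vlineP[q e]; have := sqrt_irrational q; by rewrite e eqxx.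
have bas : basis_of {:K} [:: s; 1].
  by rewrite basisEfree fr subvf /= hK.
have := coord_basis (X := [tuple s; 1]) bas (memvf x).
rewrite !big_ord_recl big_ord0 addr0 /= => ->.
by eexists; eexists; rewrite addrC.
Qed.

(** The map a + b s |-> a - b s.  Its fixed points are rational because
    (1, s) is a basis of K over Q. *)
Lemma conjugation : exists sigma : {rmorphism K -> K},
  [/\ involutive sigma, sigma s = - s
    & forall x, sigma x = x -> exists q : rat, x = q%:A].
Proof.
have ex (x : K) : exists ab : rat * rat, x == ab.1%:A + ab.2 *: s.
  by have [a [b e]] := sqrt_coord x; exists (a, b); apply/eqP.
pose co x := xchoose (ex x).
pose f x : K := (co x).1%:A - (co x).2 *: s.
have coE a b : co (a%:A + b *: s) = (a, b).
  have /eqP/esym := xchooseP (ex (a%:A + b *: s)); rewrite -/(co _).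
  by case: (co _) => a' b' /= /sqrt_coord_uniq[-> ->].
have fE a b : f (a%:A + b *: s) = a%:A - b *: s by rewrite /f coE.
have fB : zmod_morphism f.
  move=> x y; have [a [b ->]] := sqrt_coord x; have [a' [b' ->]] := sqrt_coord y.
  have -> : a%:A + b *: s - (a'%:A + b' *: s) = (a - a')%:A + (b - b') *: s.
    by rewrite !scalerBl; ring.
  by rewrite !fE !scalerBl; ring.
have scA (a : rat) : a *: s = a%:A * s by rewrite -scalerAl mul1r.
have AD (a b : rat) : (a + b)%:A = a%:A + b%:A :> K by rewrite scalerDl.
have AM (a b : rat) : (a * b)%:A = a%:A * b%:A :> K by rewrite -scalerAl mul1r scalerA.
have fM : monoid_morphism f.
  split.
    have -> : 1 = 1%:A + 0 *: s :> K by rewrite scale1r scale0r addr0.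
    by rewrite fE scale0r subr0 addr0.
  move=> x y; have [a [b ->]] := sqrt_coord x; have [a' [b' ->]] := sqrt_coord y.
  have dA : d%:~R = (d%:~R)%:A :> K by rewrite scaler_int.
  have -> : (a%:A + b *: s) * (a'%:A + b' *: s)
    = (a * a' + b * b' * d%:~R)%:A + (a * b' + a' * b) *: s.
    by rewrite !scA !AD !AM -dA -hs; ring.
  by rewrite !fE !scA !AD !AM -dA -hs; ring.
pose sigma : {rmorphism K -> K} := HB.pack f
  (GRing.isZmodMorphism.Build K K f fB) (GRing.isMonoidMorphism.Build K K f fM).
exists sigma; split=> [x||x].
- have [a [b ->]] := sqrt_coord x; rewrite /= fE -scaleNr fE scaleNr opprK //.
- have es : s = 0%:A + 1 *: s by rewrite scale0r add0r scale1r.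
  by rewrite {1}es /= fE scale0r sub0r scale1r.
have [a [b ->]] := sqrt_coord x; rewrite /= fE -scaleNr => /sqrt_coord_uniq[_ hb].
have -> : b = 0 by lra.
by exists a; rewrite scale0r addr0.
Qed.

(** The matrix whose trace defines [field_trace]. *)
Definition mul_mx (x : K) := passmx.mxof (vbasis {:K}) (vbasis {:K}) (amulr x).

Lemma mul_mxM (x y : K) : mul_mx (x * y) = mul_mx x *m mul_mx y.
Proof.
rewrite /mul_mx -passmx.mxof_comp ?vbasisP //; congr (passmx.mxof _ _ _).
by apply/lfunP => z; rewrite comp_lfunE !lfunE /= mulrA.
Qed.

Lemma mul_mx_scalar (q : rat) : mul_mx (q%:A : K) = q%:M.
Proof.
apply/matrixP => i j; rewrite !mxE /= passmx.vecof_delta !lfunE /= mulr_algr.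
rewrite linearZ /= coord_free ?(basis_free (vbasisP {:K})) //.
by rewrite mulr_natr.
Qed.

Lemma mul_mx_inj (x y : K) : mul_mx x = mul_mx y -> x = y.
Proof.
move=> e; apply: amulr_inj.
by rewrite -[LHS](passmx.mxofK (vbasisP {:K}) (vbasisP {:K})) -/(mul_mx x) e passmx.mxofK ?vbasisP.
Qed.

Lemma field_traceP (q : rat) (x y : K) :
  field_trace (q *: x + y) = q * field_trace x + field_trace y.
Proof.
rewrite /field_trace /mxtrace mulr_sumr -big_split; apply: eq_bigr => i _ /=.
rewrite !mxE /= passmx.vecof_delta !lfunE /= mulrDr -scalerAr.
by rewrite linearP.
Qed.

Lemma field_trace_sum (I : finType) (c : I -> rat) (x : I -> K) :
  field_trace (\sum_i c i *: x i) = \sum_i c i * field_trace (x i).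
Proof.
have t0 : field_trace (0 : K) = 0.
  have := field_traceP 1 0 0; rewrite scale1r addr0 mul1r => h.
  by apply: (addIr (field_trace (0 : K))); rewrite -h add0r.
by elim/big_rec2: _ => [|i a b _ IH] //; rewrite field_traceP IH.
Qed.

(** By the theorem of Cayley and Hamilton, (tr M) M = (q + det M) I. *)
Lemma mx2_square_scalar (n : nat) (M : 'M[rat]_n) (q : rat) : n = 2%N ->
  M *m M = q%:M -> \tr M = 0 \/ exists c, M = c%:M.
Proof.
move=> n2; subst n => e.
have e00 := congr1 (fun N : 'M_2 => N ord0 ord0) e.
have e01 := congr1 (fun N : 'M_2 => N ord0 ord_max) e.
have e10 := congr1 (fun N : 'M_2 => N ord_max ord0) e.
have e11 := congr1 (fun N : 'M_2 => N ord_max ord_max) e.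
move: e00 e01 e10 e11; rewrite !mxE !big_ord_recl !big_ord0 /=.
have -> : lift ord0 ord0 = ord_max :> 'I_2 by apply: val_inj.
rewrite /mxtrace !big_ord_recl !big_ord0.
have -> : lift ord0 ord0 = ord_max :> 'I_2 by apply: val_inj.
rewrite !mulr1n !mulr0n !addr0 => e00 e01 e10 e11.
have [t0|t0] := eqVneq (M ord0 ord0 + M ord_max ord_max) 0; [by left | right].
have z01 : M ord0 ord_max = 0.
  by apply: (mulIf t0); apply: (eq_lin (k := 1) e01); ring.
have z10 : M ord_max ord0 = 0.
  by apply: (mulIf t0); apply: (eq_lin (k := 1) e10); ring.
have ed : M ord_max ord_max = M ord0 ord0.
  by apply: (mulIf t0); apply: (eq_lin2 (k := 1) (k' := -1) e11 e00); ring.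
exists (M ord0 ord0); apply/matrixP => i j; rewrite mxE.
have I2 (k : 'I_2) : k = ord0 \/ k = ord_max.
  by case: k => [[|[|k]] hk] //; [left | right]; apply: val_inj.
by case: (I2 i) => ->; case: (I2 j) => ->; rewrite ?z01 ?z10 ?ed ?mulr1n ?mulr0n.
Qed.

Lemma field_trace1 (q : rat) : field_trace (q%:A : K) = 2 * q.
Proof.
rewrite /field_trace -/(mul_mx _) mul_mx_scalar mxtrace_scalar.
by rewrite (_ : \dim {:K} = 2%N) // mulr2n mulr_natl.
Qed.

(** Multiplication by s squares to d; were its trace not 0, it would be a
    scalar, and s a rational number. *)
Lemma field_trace_sqrt : field_trace s = 0.
Proof.
have e : mul_mx s *m mul_mx s = (d%:~R)%:M.
  by rewrite -mul_mxM -expr2 hs -mul_mx_scalar scaler_int.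
have [//|[c hc]] := mx2_square_scalar hK e.
have := sqrt_irrational c; rewrite (mul_mx_inj (x := s) (y := c%:A)) ?eqxx //.
by rewrite mul_mx_scalar.
Qed.

Lemma det2_diag (n : nat) (M : 'M[rat]_n) (x y : rat) : n = 2%N ->
  (forall i j : 'I_n, M i j = if (i : nat) == j then (if (i : nat) == 0%N then x else y) else 0) ->
  \det M = x * y.
Proof.
move=> n2; subst n => hM; rewrite (expand_det_row _ ord0) !big_ord_recl big_ord0 /=.
rewrite /cofactor !det_mx11 !mxE !hM /= mul0r !addr0 addn0 expr0 mul1r.
by congr (_ * _).
Qed.

Lemma sqrt_integer : algebraic_integer s.
Proof.
exists ('X^2 - d%:P); first by rewrite monicXnsubC.
rewrite rmorphB /= map_polyXn map_polyC /= rootE !hornerE /= hs.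
by rewrite subrr.
Qed.

(** Expressing 1 and s in an integral basis gives an integral matrix M of
    determinant f, and the Gram matrix of (1, s) for the trace form, which is
    diagonal with entries 2 and 2 d, is M G M^T. *)
Lemma quadratic_discriminant (dK : int) : is_field_discriminant K dK ->
  exists f : int, 4 * d = f ^+ 2 * dK.
Proof.
case=> b [[_ intb] eD].
have [c hc] : exists c : 'I_(\dim {:K}) -> int, 1 = \sum_i (c i)%:~R * b`_i.
  by apply/intb; apply: (@integral1 _ _ (intr : {rmorphism int -> K})).
have [c' hc'] : exists c : 'I_(\dim {:K}) -> int, s = \sum_i (c i)%:~R * b`_i.
  by apply/intb; exact: sqrt_integer.
pose M : 'M[int]_(\dim {:K}) := \matrix_(i, j) if (i : nat) == 0%N then c j else c' j.
pose G := \matrix_(i < \dim {:K}, j < \dim {:K}) field_trace (b`_i * b`_j).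
pose MQ : 'M[rat]_(\dim {:K}) := map_mx intr M.
pose e (i : 'I_(\dim {:K})) : K := if (i : nat) == 0%N then 1 else s.
have eE i : e i = \sum_j MQ i j *: b`_j.
  rewrite /e; case: ifP => h; [apply: (etrans hc) | apply: (etrans hc')].
    by apply: eq_bigr => j _; rewrite !mxE h scaler_int mulrzl.
  by apply: eq_bigr => j _; rewrite !mxE h scaler_int mulrzl.
exists (\det M); apply/eqP; rewrite -(eqr_int rat) [X in _ == X]rmorphM rmorphXn.
rewrite [X in X == _]rmorphM /= eD -/G.
rewrite -det_map_mx -/MQ; apply/eqP.
have -> : (\det MQ) ^+ 2 * \det G = \det (MQ *m G *m MQ^T).
  by rewrite !det_mulmx det_tr; ring.
rewrite (@det2_diag _ _ 2 (2 * d%:~R)) //; first by rewrite -(rmorph_nat intr); ring.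
move=> i j.
have -> : (MQ *m G *m MQ^T) i j = field_trace (e i * e j).
  rewrite (eE i) mulr_suml.
  have -> : \sum_k MQ i k *: b`_k * e j = \sum_k MQ i k *: (b`_k * e j).
    by apply: eq_bigr => k _; rewrite scalerAl.
  rewrite field_trace_sum !mxE.
  under eq_bigr => l _ do rewrite !mxE mulr_suml.
  rewrite exchange_big /=; apply: eq_bigr => k _.
  have -> : field_trace (b`_k * e j) = \sum_l MQ j l * field_trace (b`_k * b`_l).
    rewrite -field_trace_sum (eE j) mulr_sumr; congr field_trace.
    by apply: eq_bigr => l _; rewrite scalerAr.
  by rewrite mulr_sumr; apply: eq_bigr => l _; rewrite !mxE; ring.
have tr1 : field_trace (1 : K) = 2 by rewrite -[1]scale1r field_trace1 mulr1.
have trd : field_trace (s * s) = 2 * d%:~R.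
  by rewrite -expr2 hs -scaler_int field_trace1.
have hi : (i < 2)%N := leq_trans (ltn_ord i) (eq_leq hK).
have hj : (j < 2)%N := leq_trans (ltn_ord j) (eq_leq hK).
rewrite /e; case: ifP => i0; case: ifP => j0; rewrite ?mul1r ?mulr1.
- by rewrite (eqP i0) (eqP j0) eqxx.
- by rewrite (eqP i0) eq_sym j0 field_trace_sqrt.
- by rewrite (eqP j0) i0 field_trace_sqrt.
rewrite trd ifT ?i0 //; move: hi hj i0 j0.
by case: (i : nat) (j : nat) => [|[|?]] [|[|?]].
Qed.

(** As d is square-free, 9 does not divide 4 d = f^2 d_K, hence 3 does not
    divide f when it divides d. *)
Lemma dvd3_discriminant (dK : int) : square_free d -> is_field_discriminant K dK ->
  (3 %| dK)%Z <-> (3 %| d)%Z.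
Proof.
move=> sq /quadratic_discriminant[f e]; split=> h.
  by have : (3 %| 4 * d)%Z; [rewrite e dvdz_mull | rewrite dvd3M].
have [d' ed nd] := square_free3 sq h.
have [/dvdzP[g ef]|nf] := boolP (3 %| f)%Z.
  case/negP: nd; have : (3 %| 4 * d')%Z; last by rewrite dvd3M.
  apply/dvdzP; exists (g ^+ 2 * dK); apply: (mulfI (_ : 3 != 0)) => //.
  by apply: (eq_lin (k := 1) e); rewrite ed ef; ring.
have : (3 %| f ^+ 2 * dK)%Z by rewrite -e dvdz_mull.
by rewrite dvd3M dvd3X (negbTE nf).
Qed.

End QuadraticExtension.

(** * From the point of order 9 to the theorem *)

(** The discriminant of y^2 + m x y + n y = x^3. *)
Lemma flex_form_wdisc (F : fieldType) (W : weierstrass F) r m n : 4 != 0 :> F ->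
  flex_form W r m n -> wdisc W = n ^+ 3 * (m ^+ 3 - 27 * n).
Proof.
move=> k4 [e2 e4 e6].
have b8E : 4 * wb8 W = wb2 W * wb6 W - wb4 W ^+ 2.
  by rewrite /wb8 /wb2 /wb6 /wb4; ring.
apply: (mulfI k4); rewrite /wdisc; move: b8E; rewrite e2 e4 e6 => b8E.
by apply: (eq_lin (k := - (m ^+ 2 - 12 * r) ^+ 2) b8E); ring.
Qed.

Lemma map_weierstrass_wb (F K : fieldType) (f : {rmorphism F -> K}) W :
  [/\ wb2 (map_weierstrass f W) = f (wb2 W), wb4 (map_weierstrass f W) = f (wb4 W),
      wb6 (map_weierstrass f W) = f (wb6 W) & wdisc (map_weierstrass f W) = f (wdisc W)].
Proof.
rewrite /wdisc /wb2 /wb4 /wb6 /wb8 /=.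
by split; rewrite !(rmorph_nat, rmorphXn, rmorphM, rmorphN, rmorphB, rmorphD).
Qed.

Lemma twist_modelE (d A B : int) :
  let D : rat := d%:~R in let a : rat := A%:~R in let b : rat := B%:~R in
  twist_model d A B
  = Weierstrass 0 (D * a ^+ 2) 0 (8 * D ^+ 2 * a * b ^+ 3) (16 * D ^+ 3 * b ^+ 6).
Proof.
rewrite /twist_model /map_weierstrass /=.
by congr Weierstrass; rewrite !(rmorph_nat, rmorphXn, rmorphM).
Qed.

Section TwistDescent.
Variables (K : fieldType) (f : {rmorphism rat -> K}) (sigma : {rmorphism K -> K}).
Hypothesis sigma_fixed : forall x, sigma x = x -> exists q : rat, x = f q.
Hypothesis sigmaK : involutive sigma.
Variables (s : K) (d : int).
Hypothesis s2 : s ^+ 2 = d%:~R.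
Hypothesis s0 : s != 0.
Hypothesis sigma_s : sigma s = - s.

(** By [flex_x_rational] and [flex_param_rational], r and t are rational and
    sigma(u) is u or -u.  In the first case the coordinates of P are rational.  In
    the second one, u is a rational multiple of s, and the coefficients of the
    equation of E are those of the twist. *)
Lemma order9_point_twist (E : weierstrass rat) (P : point K) :
  is_elliptic E -> let EK := map_weierstrass f E in
  is_point EK P -> point_order EK P 9 ->
  ~ (exists Q : point rat, is_point E Q /\ P = map_point f Q) ->
  exists t : rat, [/\ B9 t != 0, A9 t ^+ 3 - 27 * B9 t ^+ 3 != 0
    & is_model_of E (twist_model d (A9h (numq t) (denq t)) (B9h (numq t) (denq t)))].
Proof.
move=> hE EK; case: P => [[x y]|]; last first.
  by move=> _ [_ _ Pn] _; case: (Pn 1%N).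
move=> hP ord nrat; have [t [u [u0 c0 fl Y]]] := order9_param hP ord.
set c := t ^+ 2 * (t - 1) in c0 fl Y; set r := x + u ^+ 2 * c in fl.
have [b2E b4E b6E bDE] := map_weierstrass_wb f E.
have k2 : 2 != 0 :> K := natK_neq0 f 1.
have k4 : 4 != 0 :> K := natK_neq0 f 3.
have D0 : wdisc EK != 0 by rewrite bDE fmorph_eq0.
rewrite (flex_form_wdisc k4 fl) mulf_eq0 negb_or in D0; case/andP: D0 => n0 D0.
have B0 : B9 t != 0.
  by apply: contraNneq n0 => B0; rewrite B0 mulr0 !expr0n.
have d0 : A9 t ^+ 3 - 27 * B9 t ^+ 3 != 0.
  apply: contraNneq D0 => e; apply/eqP.
  have : u ^+ 3 * (A9 t ^+ 3 - 27 * B9 t ^+ 3) = 0 by rewrite e mulr0.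
  by move=> h; apply: (eq_lin (k := 1) h); ring.
have m0 : u * A9 t != 0 by rewrite mulf_neq0 // (A9_neq0 sigma_fixed sigmaK).
have v0 : u * B9 t != 0 by rewrite mulf_neq0.
have sr : sigma r = r := flex_x_rational sigma_fixed sigmaK fl m0 v0 D0.
have [r0 er] := sigma_fixed sr.
have fr q : sigma (f q) = f q by apply: sigma_rat.
have [e2 e4 e6] := fl; rewrite b2E b4E b6E in e2 e4 e6.
have [b2 eb2] : exists b2, wb2 E = b2 by eexists.
have [b4 eb4] : exists b4, wb4 E = b4 by eexists.
have [b6 eb6] : exists b6, wb6 E = b6 by eexists.
rewrite eb2 in e2; rewrite eb4 in e4; rewrite eb6 in e6.
set m := u * A9 t in e2 e4 e6 m0 fl; set n := (u * B9 t) ^+ 3 in e2 e4 e6 fl.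
have m2 : m ^+ 2 = f (b2 + 12 * r0).
  by rewrite rmorphD rmorphM rmorph_nat e2 er; ring.
have mn : m * n = f (b4 - 6 * r0 ^+ 2 + r0 * (b2 + 12 * r0)).
  rewrite !(rmorph_nat, rmorphXn, rmorphM, rmorphB, rmorphD) e4 e2 er; ring.
have n2 : n ^+ 2 = f (b6 + 4 * r0 ^+ 3 + 2 * r0 * (b4 - 6 * r0 ^+ 2 + r0 * (b2 + 12 * r0))
    - r0 ^+ 2 * (b2 + 12 * r0)).
  rewrite rmorphB rmorphD (rmorphM _ (2 * r0)) -mn (rmorphM _ (r0 ^+ 2)) -m2.
  clearbody m n; by rewrite !(rmorph_nat, rmorphXn, rmorphM, rmorphD) e6 er; ring.
have sm : sigma (m ^+ 2) = m ^+ 2 by rewrite m2 fr.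
have smn : sigma (m * n) = m * n by rewrite mn fr.
have sn : sigma (n ^+ 2) = n ^+ 2 by rewrite n2 fr.
have [t0 [et su]] :=
  flex_param_rational sigma_fixed sigmaK (erefl m) (erefl n) u0 B0 d0 sm smn sn.
exists t0; have Bt0 : B9 t0 != 0 by move: B0; rewrite et -rmorph_B9 fmorph_eq0.
have dt0 : A9 t0 ^+ 3 - 27 * B9 t0 ^+ 3 != 0.
  move: d0; rewrite et -rmorph_A9 -rmorph_B9 -(rmorph_nat f) -!rmorphXn -rmorphM -rmorphB.
  by rewrite fmorph_eq0.
case: su => su.
  case: nrat; have [u1 eu] := sigma_fixed su.
  pose c1 := t0 ^+ 2 * (t0 - 1).
  have ec : c = f c1 by rewrite /c et rmorphM rmorphB rmorphXn rmorph1.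
  pose x0 := r0 - u1 ^+ 2 * c1.
  pose y0 := (u1 ^+ 3 * (c1 * (t0 ^+ 2 - t0 + 1)) - wa1 E * x0 - wa3 E) / 2.
  have ex : x = f x0 by rewrite rmorphB rmorphM rmorphXn -er -eu -ec /r addrK.
  have ey : y = f y0.
    rewrite fmorph_div !rmorphB (rmorphM _ (wa1 E)) -ex (rmorphM _ (u1 ^+ 3)) (rmorphM _ c1).
    rewrite rmorphD rmorphB !rmorphXn rmorph1 rmorph_nat -ec -eu -et.
    by rewrite -Y /=; field.
  clearbody x0 y0; exists (Some (x0, y0)); split; last by rewrite /= -ex -ey.
  move: hP; rewrite /= /on_curve /= ex ey => h.
  by apply: (fmorph_inj f); rewrite !(rmorphXn, rmorphM, rmorphD).
have [u1 eu] : exists u1, u / s = f u1.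
  by apply: sigma_fixed; rewrite fmorph_div su sigma_s invrN mulrNN.
have {}eu : u = f u1 * s by rewrite -eu divfK.
have u10 : u1 != 0 by move: u0; rewrite eu mulf_eq0 negb_or fmorph_eq0 => /andP[].
have [a ea] : exists a, A9 t0 = a by eexists.
have [b eb] : exists b, B9 t0 = b by eexists.
have s2f : s ^+ 2 = f d%:~R by rewrite s2 rmorph_int.
have fa : f a = A9 t by rewrite -ea rmorph_A9 -et.
have fb : f b = B9 t by rewrite -eb rmorph_B9 -et.
have m2f : m ^+ 2 = f (u1 ^+ 2 * d%:~R * a ^+ 2).
  by rewrite !(rmorphXn, rmorphM) fa -s2f /m eu; ring.
have mnf : m * n = f (u1 ^+ 4 * d%:~R ^+ 2 * a * b ^+ 3).
  by rewrite !(rmorphXn, rmorphM) fa fb -s2f /m /n eu; ring.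
have n2f : n ^+ 2 = f (u1 ^+ 6 * d%:~R ^+ 3 * b ^+ 6).
  by rewrite !(rmorphXn, rmorphM) fb -s2f /n eu; ring.
have h2 := fmorph_inj f (etrans (esym m2) m2f).
have h4 := fmorph_inj f (etrans (esym mn) mnf).
have h6 := fmorph_inj f (etrans (esym n2) n2f).
have q0 : (denq t0)%:~R != 0 :> rat by rewrite intr_eq0 denq_eq0.
rewrite twist_modelE /= -A9_frac -B9_frac ea eb.
have k2q : 2 != 0 :> rat by [].
move: h2 h4 h6 q0; move: (denq t0)%:~R d%:~R => q D h2 h4 h6 q0.
split; [by rewrite -eb | by rewrite -ea -eb | apply: (@is_model_of_b _ E (u1 / (2 * q ^+ 3)) r0) => //].
- by rewrite mulf_neq0 ?invr_eq0 ?mulf_neq0 ?expf_neq0.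
- by rewrite eb2; apply: (eq_lin (k := 1) h2); field; rewrite q0.
- by rewrite eb2 eb4; apply: (eq_lin (k := 1) h4); field; rewrite q0.
- by rewrite eb2 eb4 eb6; apply: (eq_lin (k := 1) h6); field; rewrite q0.
Qed.
End TwistDescent.

Theorem theorem5
  (E : weierstrass rat) (hE : is_elliptic E)
  (d : int) (hd : square_free d)
  (K : fieldExtType rat) (hK : \dim {:K} = 2%N)
  (sqrtd : K) (hsqrtd : sqrtd ^+ 2 = d%:~R)
  (hgen : <<1%VS; sqrtd>>%VS = {:K}%VS)
  (dK : int) (hdK : is_field_discriminant K dK)
  (hP : let EK := map_weierstrass (in_alg K) E in
        exists P : point K,
          [/\ is_point EK P,
              point_mul EK 9 P = None,
              ~ (exists Q : point rat,
                   is_point E Q /\ P = map_point (in_alg K) Q)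
            & point_order EK P 9]) :
  (3 %| dK)%Z <->
  (additive_reduction 3 E /\ ~ has_kodaira_symbol 3 E KIV).
Proof.
have [sigma [sK ss sfix]] := conjugation hK hsqrtd hgen.
have [P [onE _ nrat ord]] := hP.
have s0 : sqrtd != 0.
  by have := sqrt_irrational hK hgen 0; rewrite scale0r.
have [t [B0 D0 model]] :=
  @order9_point_twist K (in_alg K) sigma sfix sK sqrtd d hsqrtd s0 ss E P hE onE ord nrat.
rewrite (dvd3_discriminant hK hsqrtd hgen hd hdK).
set A := A9h _ _ in model; set B := B9h _ _ in model.
have q0 : (denq t)%:~R != 0 :> rat by rewrite intr_eq0 denq_eq0.
have hB : B != 0.
  by rewrite -(intr_eq0 rat) -B9_frac mulf_neq0 // expf_neq0.
have hD : A ^+ 3 - 27 * B ^+ 3 != 0.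
  have cast (x y : int) : (x ^+ 3 - 27 * y ^+ 3)%:~R = x%:~R ^+ 3 - 27 * y%:~R ^+ 3 :> rat.
    by rewrite !(rmorph_nat, rmorphXn, rmorphM, rmorphB).
  rewrite -(intr_eq0 rat) cast -A9_frac -B9_frac.
  rewrite (_ : _ - _ = (A9 t ^+ 3 - 27 * B9 t ^+ 3) * (denq t)%:~R ^+ 9); last by ring.
  by rewrite mulf_neq0 // expf_neq0.
have cop : coprimez (numq t) (denq t) by rewrite coprimezE coprime_num_den.
have [[nA dB]|[b [nb nB eA]]] := reduction_cases cop.
  exact: (twist_cuspidal_case hE hd model hD hB nA dB).
exact: (twist_wild_case hE hd model hD hB nb nB eA).
Qed.
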